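(* Let $\mathbb{k}$ be a field of characteristic zero, let $\mathrm{PreLie}$ be the operad of pre-Lie algebras over $\mathbb{k}$, and let $F^\bullet\mathrm{PreLie}$ be its Lie filtration. Then the associated graded operad is isomorphic to the operad of $F$-manifold algebras: \[ \mathrm{gr}_F\,\mathrm{PreLie}\cong \mathrm{FMan} \] as operads. In particular, $\dim \mathrm{FMan}(n)=n^{n-1}$ for all $n\ge 1$, and the $S_n$-module $\mathrm{FMan}(n)$ is isomorphic to the permutation module spanned by rooted trees with vertex set $\{1,\ldots,n\}$.
   Context: All operads are symmetric operads of graded vector spaces over a field $\mathbb{k}$ of characteristic zero, reduced ($\mathcal{P}(0)=0$) and connected ($\mathcal{P}(1)=\mathbb{k}$). The operad $\mathrm{PreLie}$ is generated by one binary operation $a_1\cdot a_2$ with no symmetry, subject to the relation $(a_1\cdot a_2)\cdot a_3 - a_1\cdot (a_2\cdot a_3) = (a_1\cdot a_3)\cdot a_2- a_1\cdot (a_3\cdot a_2)$. In $\mathrm{PreLie}$, consider the symmetrised product $a_1\circ a_2=a_1\cdot a_2+a_2\cdot a_1$ and the bracket $[a_1,a_2]=a_1\cdot a_2-a_2\cdot a_1$; these two operations generate $\mathrm{PreLie}$. The Lie filtration $F^\bullet\mathrm{PreLie}$ is the filtration by powers of the operadic ideal generated by the bracket $[-,-]$; equivalently, $F^k\mathrm{PreLie}$ is the span of tree tensors (composites of the operations $\circ$ and $[-,-]$) in which at least $k$ vertices are labelled by $[-,-]$. The operad $\mathrm{FMan}$ of $F$-manifold algebras is generated by a symmetric binary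 operation $-\circ-$ and a skew-symmetric binary operation $[-,-]$ subject to associativity $(a_1\circ a_2)\circ a_3=a_1\circ(a_2\circ a_3)$, the Jacobi identity $[[a_1,a_2], a_3]+[[a_2,a_3], a_1]+[[a_3,a_1],a_2]=0$, and the Hertling--Manin relation \begin{multline*} [a_1\circ a_2,a_3\circ a_4]= [a_1\circ a_2, a_3]\circ a_4+[a_1\circ a_2, a_4]\circ a_3+a_1\circ [a_2, a_3\circ a_4]+a_2\circ [a_1, a_3\circ a_4]-\\ (a_1\circ a_3)\circ[a_2,a_4]-(a_2\circ a_3)\circ[a_1,a_4]-(a_2\circ a_4)\circ[a_1,a_3]-(a_1\circ a_4)\circ[a_2,a_3] . \end{multline*} *)

(* Defs.v *)
From HB Require Import structures.
From mathcomp Require Import all_boot all_order all_algebra all_fingroup.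
Set Implicit Arguments. Unset Strict Implicit. Unset Printing Implicit Defensive.
Import GRing.Theory.
Local Open Scope ring_scope.

Section Trees.
Variable L : eqType.

Inductive tree := Leaf of nat | Node of L & tree & tree.

Fixpoint tree_eqb (t u : tree) : bool :=
  match t, u with
  | Leaf i, Leaf j => i == j
  | Node a l r, Node b l' r' => [&& a == b, tree_eqb l l' & tree_eqb r r']
  | _, _ => false
  end.

Lemma tree_eqP : Equality.axiom tree_eqb.
Proof.
elim=> [i|a l IHl r IHr] [j|b l' r'] /=; try by constructor.
- by apply: (iffP eqP) => [->|[]].
- case: eqP => [->|ne] /=; last by constructor=> -[].
  case: IHl => [->|ne] /=; last by constructor=> -[].
  by case: IHr => [->|ne]; constructor=> // -[].
Qed.

HB.instance Definition _ := hasDecEq.Build tree tree_eqP.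

Fixpoint leaves (t : tree) : seq nat :=
  match t with Leaf i => [:: i] | Node _ l r => leaves l ++ leaves r end.

Fixpoint tsubst (s : nat -> tree) (t : tree) : tree :=
  match t with Leaf i => s i | Node a l r => Node a (tsubst s l) (tsubst s r) end.

Definition arity (n : nat) (t : tree) : bool := perm_eq (leaves t) (iota 0 n).

End Trees.
Arguments Leaf {L}.

Section Comb.
Variables (k : fieldType) (L : eqType).

Definition comb := seq (k * tree L).

Definition coef (c : comb) (t : tree L) : k :=
  \sum_(p <- c) (p.2 == t)%:R * p.1.

Definition cscale (a : k) (c : comb) : comb := [seq (a * p.1, p.2) | p <- c].
Definition csub (c d : comb) : comb := c ++ cscale (-1) d.

Definition csubst (s : nat -> tree L) (c : comb) : comb :=
  [seq (p.1, tsubst s p.2) | p <- c].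

Definition graft (T : tree L) (j : nat) (c : comb) : comb :=
  [seq (p.1, tsubst (fun i => if i == j then p.2 else Leaf i) T) | p <- c].

(* all trees of c have arity n, i.e. c is an element of the arity-n component
   of the free operad *)
Definition all_arity (n : nat) (c : comb) : bool := all (fun p => arity n p.2) c.

Definition in_span (G : comb -> Prop) (v : comb) : Prop :=
  exists gs : seq (k * comb),
    (forall p, p \in gs -> G p.2) /\
    coef v =1 coef (flatten [seq cscale p.1 p.2 | p <- gs]).

(* spanning elements of the arity-n component of the operadic ideal generated
   by the relations R: one vertex of a tree tensor is replaced by a relation
   (the relation r, with arbitrary trees substituted for its inputs, is grafted
   into the unique leaf labelled j of the tree T) *)
Definition ideal_gen (R : seq comb) (n : nat) (g : comb) : Prop :=
  exists r (T : tree L) (j : nat) (s : nat -> tree L),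
    [/\ r \in R, count_mem j (leaves T) = 1%N,
        g = graft T j (csubst s r) & all_arity n g].

Definition lincomb (c : nat -> k) (bs : seq comb) : comb :=
  flatten [seq cscale (c i) (nth [::] bs i) | i <- iota 0 (size bs)].

Definition basis_mod (I : comb -> Prop) (n : nat) (bs : seq comb) : Prop :=
  [/\ forall b, b \in bs -> all_arity n b,
      (forall c : nat -> k, in_span I (lincomb c bs) ->
         forall i, (i < size bs)%N -> c i = 0) &
      (forall x, all_arity n x -> exists c : nat -> k,
         in_span I (csub x (lincomb c bs)))].

End Comb.

(* one binary generator a1 . a2 without symmetry; vertex labels in unit *)
Section PreLie.
Variable k : fieldType.
Local Notation X := (@Leaf unit).
Local Notation dot := (Node tt).

Definition prelie_rels : seq (comb k unit) :=
  [:: [:: (1, dot (dot (X 0) (X 1)) (X 2)); (-1, dot (X 0) (dot (X 1) (X 2)));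
          (-1, dot (dot (X 0) (X 2)) (X 1)); (1, dot (X 0) (dot (X 2) (X 1)))] ].

(* label false = symmetrised product  a o b, label true = bracket [a,b] *)
Fixpoint nbrk (t : tree bool) : nat :=
  match t with Leaf _ => 0 | Node b l r => b + nbrk l + nbrk r end.

(* the element of (free) PreLie represented by a tree tensor:
   a o b = a.b + b.a , [a,b] = a.b - b.a *)
Fixpoint ev (t : tree bool) : comb k unit :=
  match t with
  | Leaf i => [:: (1, X i)]
  | Node b l r =>
      let sg : k := if b then -1 else 1 in
      flatten [seq flatten [seq [:: (p.1 * q.1, dot p.2 q.2);
                                    (sg * (p.1 * q.1), dot q.2 p.2)]
                           | q <- ev r] | p <- ev l]
  end.

Definition ev_comb (x : comb k bool) : comb k unit :=
  flatten [seq cscale p.1 (ev p.2) | p <- x].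

(* spanning set of (the preimage in the free operad of) F^j PreLie(n):
   tree tensors of arity n with at least j brackets, plus the PreLie ideal *)
Definition Fgen (n j : nat) (v : comb k unit) : Prop :=
  (exists t, arity n t /\ (j <= nbrk t)%N /\ v = ev t)
  \/ ideal_gen prelie_rels n v.
End PreLie.

Section FMan.
Variable k : fieldType.
Local Notation X := (@Leaf bool).
Local Notation o := (Node false).
Local Notation br := (Node true).

Definition fman_rels : seq (comb k bool) :=
  [::
      [:: (1, o (X 0) (X 1)); (-1, o (X 1) (X 0))];
      [:: (1, br (X 0) (X 1)); (1, br (X 1) (X 0))];
      [:: (1, o (o (X 0) (X 1)) (X 2)); (-1, o (X 0) (o (X 1) (X 2)))];
      [:: (1, br (br (X 0) (X 1)) (X 2)); (1, br (br (X 1) (X 2)) (X 0));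
          (1, br (br (X 2) (X 0)) (X 1))];
      (* Hertling--Manin, a_i = X (i-1) *)
      [:: (1, br (o (X 0) (X 1)) (o (X 2) (X 3)));
          (-1, o (br (o (X 0) (X 1)) (X 2)) (X 3));
          (-1, o (br (o (X 0) (X 1)) (X 3)) (X 2));
          (-1, o (X 0) (br (X 1) (o (X 2) (X 3))));
          (-1, o (X 1) (br (X 0) (o (X 2) (X 3))));
          (1, o (o (X 0) (X 2)) (br (X 1) (X 3)));
          (1, o (o (X 1) (X 2)) (br (X 0) (X 3)));
          (1, o (o (X 1) (X 3)) (br (X 0) (X 2)));
          (1, o (o (X 0) (X 3)) (br (X 1) (X 2)))] ].

Definition fman_ideal (n : nat) : comb k bool -> Prop := ideal_gen fman_rels n.
End FMan.

Definition relabel_nat (n : nat) (s : 'S_n) (i : nat) : nat :=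
  oapp (fun j : 'I_n => val (s j)) i (insub i).

Definition relabel (k : fieldType) (n : nat) (s : 'S_n) (c : comb k bool) :=
  csubst (fun i => Leaf (relabel_nat s i)) c.

(* given by the parent function (None = the root) *)
Definition rooted (n : nat) (f : {ffun 'I_n -> option 'I_n}) : bool :=
  (#|[pred i | f i == None]| == 1)%N &&
  [forall i, iter n (fun o => obind f o) (Some i) == None].

Definition rtree (n : nat) := {f : {ffun 'I_n -> option 'I_n} | rooted f}.

(* Main.v *)
(** The FMan relations hold in gr_F PreLie by explicit identities, so the
canonical map FMan -> gr_F PreLie is well defined and onto; it is an
isomorphism once FMan(n) is spanned by |RT(n)| elements and PreLie(n) has at
least that dimension, where RT(n) is the set of rooted trees on n vertices.

Lower bound: let PreLie act on rooted trees by grafting.  The coefficient of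
the tree with parent function par in a magma monomial t is the product, over
the vertices (l, r) of t, of the number of leaves of l equal to par(root r).
Multiplying the children of each vertex onto it one after another gives
monomials that are unitriangular with respect to the total depth.

Upper bound: by the Hertling--Manin relation the span C of products is closed
under the bracket, so modulo terms with fewer factors the words
[..[[x, a_1], a_2], .., a_k], with x a generator and each a_i either in C or a
non-product whose smallest generator exceeds x, do not depend on the order of
the a_i.  Such words span the non-products, and products of them span
everything.  Attaching to the word with the largest x the other factors of a
product as further children encodes these elements by rooted trees.

For the S_n-structure the resulting linear isomorphism FMan(n) -> k[RT(n)] is
averaged over S_n; the average is the same canonical map on the associated
graded, hence still invertible.  Finally |RT(n)| = n^(n-1) by Pitman's double
counting of rooted forests. *)

Require Import Defs.
From HB Require Import structures.
From mathcomp Require Import all_boot all_order all_algebra all_fingroup.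
From mathcomp Require Import ring zify.
Set Implicit Arguments. Unset Strict Implicit. Unset Printing Implicit Defensive.
Import GRing.Theory.
Local Open Scope ring_scope.

(** The two bounds meet in one square matrix [Qmx], whose rows are the rooted-tree coordinates in
    PreLie(n) of the normal forms of FMan(n). Normal forms span only modulo the FMan ideal, and that
    ideal does not vanish in PreLie. It is, however, homogeneous in the number of brackets and is
    sent one filtration step deeper; a tree with n leaves has fewer than n brackets, so rewriting
    the error terms stops and the rows span. Once [Qmx] is invertible, each element of PreLie(n) has
    coordinates in the normal forms, and keeping only those in the bracket degree of a tree tensor
    gives functionals on FMan(n) dual to the normal forms. Kernels and bases are then read off from
    functionals and spans; no quotient space is formed. Characteristic zero enters twice: 1/2
    recovers a.b from a o b and [a,b], and 1/n! serves the averaging. The averaging is there because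
    the normal forms depend on the order of the labels. *)

Local Notation o := (Node false).
Local Notation br := (Node true).

(** * Spans and operadic ideals *)

Section Span.
Variables (k : fieldType) (L : eqType).
Local Notation fn := (tree L -> k).
Implicit Types (G : fn -> Prop) (f g h : fn) (c d : comb k L).

Definition single (t : tree L) : fn := fun u => (t == u)%:R.

Lemma coefc_nil t : coef ([::] : comb k L) t = 0.
Proof. by rewrite /coef big_nil. Qed.

Lemma coefc_cons p c t : coef (p :: c) t = p.1 * single p.2 t + coef c t.
Proof. by rewrite /coef big_cons mulrC. Qed.

Lemma coefc_cat c d t : coef (c ++ d) t = coef c t + coef d t.
Proof. by rewrite /coef big_cat. Qed.

Lemma coef_cscale a c t : coef (cscale a c) t = a * coef c t.
Proof.
elim: c => [|p c IH]; first by rewrite coefc_nil mulr0.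
by rewrite [cscale _ _]/= !coefc_cons IH mulrDr mulrA.
Qed.

Lemma coef_csub c d t : coef (csub c d) t = coef c t - coef d t.
Proof. by rewrite coefc_cat coef_cscale mulN1r. Qed.

Definition coefcE := (coefc_nil, coefc_cons, coefc_cat, coef_cscale, coef_csub).

(** Spans live among coefficient functions because one element has many list representations as a
    [comb]; the pointwise equations in both constructors take the place of function
    extensionality. *)
Inductive spn G : fn -> Prop :=
| spn0 f : f =1 (fun=> 0) -> spn G f
| spnD a g f h : G g -> spn G f -> h =1 (fun t => a * g t + f t) -> spn G h.

Lemma spn_ext G f h : h =1 f -> spn G f -> spn G h.
Proof.
move=> hf sf; elim: sf h hf => {f} [f f0|a g f f' Gg sf _ ef] h hf.
  by apply: spn0 => t; rewrite hf f0.
by apply: (spnD Gg sf) => t; rewrite hf ef.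
Qed.

Lemma spn_lin G a f g h :
  spn G f -> spn G g -> h =1 (fun t => a * f t + g t) -> spn G h.
Proof.
move=> sf; elim: sf g h => {f} [f f0|b u f f' Gu _ IH ef] g h sg hE.
  by apply: (spn_ext _ sg) => t; rewrite hE f0 mulr0 add0r.
have sfg : spn G (fun t => a * f t + g t) by exact: IH sg (frefl _).
apply: (@spnD _ (a * b) u _ _ Gu sfg) => t.
by rewrite hE ef; ring.
Qed.

Lemma spn_gen G g : G g -> spn G g.
Proof.
by move=> Gg; apply: (@spnD _ 1 g (fun=> 0) _ Gg) => [|t]; [apply: spn0|rewrite mul1r addr0].
Qed.

Lemma spn_add G f g h : spn G f -> spn G g -> h =1 (fun t => f t + g t) -> spn G h.
Proof. by move=> sf sg e; apply: (@spn_lin _ 1 _ _ _ sf sg) => t; rewrite mul1r. Qed.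

Lemma spn_sub G f g h : spn G f -> spn G g -> h =1 (fun t => f t - g t) -> spn G h.
Proof.
by move=> sf sg e; apply: (@spn_lin _ (-1) _ _ _ sg sf) => t; rewrite mulN1r addrC.
Qed.

Lemma spn_scale G a f h : spn G f -> h =1 (fun t => a * f t) -> spn G h.
Proof.
move=> sf e; apply: (@spn_lin _ a _ (fun=> 0) _ sf) => [|t]; first exact: spn0.
by rewrite e addr0.
Qed.

Fixpoint lincombf (s : seq (k * fn)) : fn :=
  fun t => if s is p :: s' then p.1 * p.2 t + lincombf s' t else 0.

Fixpoint AllP (T : Type) (P : T -> Prop) (s : seq T) : Prop :=
  if s is x :: s' then P x /\ AllP P s' else True.

Lemma spn_lincombf G s f : AllP (fun p => spn G p.2) s -> f =1 lincombf s -> spn G f.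
Proof.
elim: s f => [|p s IH] f /= => [_|[Gp Gs]] fE; first exact: spn0.
by apply: (spn_lin Gp (IH _ Gs (frefl _)) fE).
Qed.

Lemma in_spanE (Gc : comb k L -> Prop) v :
  in_span Gc v <-> spn (fun f => exists2 c, Gc c & f =1 coef c) (coef v).
Proof.
split=> [[gs [Ggs vE]]|].
  apply: (spn_ext vE) => {v vE}.
  elim: gs Ggs => [|p gs IH] Ggs /=; first by apply: spn0 => t; rewrite coefc_nil.
  have sgs : forall q, q \in gs -> Gc q.2 by move=> q qg; apply: Ggs; rewrite inE qg orbT.
  apply: (@spnD _ p.1 (coef p.2) _ _ _ (IH sgs)) => [|t].
    by exists p.2 => //; apply: Ggs; rewrite inE eqxx.
  by rewrite coefc_cat coef_cscale.
move E: (coef v) => f sf; have {E} vf : coef v =1 f by rewrite E.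
elim: sf v vf => {f} [f f0|a g f h [c Gc_c gE] _ IH hE] v vf.
  by exists [::]; split=> // t; rewrite vf f0 coefc_nil.
have [|gs [Ggs E]] := IH (v ++ cscale (- a) c).
  by move=> t; rewrite !coefcE vf hE gE; ring.
exists ((a, c) :: gs); split=> [p|t].
  by rewrite inE => /predU1P[->|] //; apply: Ggs.
rewrite /= !coefcE -E !coefcE; ring.
Qed.

Lemma spn_trans G G' f : (forall g, G g -> spn G' g) -> spn G f -> spn G' f.
Proof.
move=> GG'; elim=> {f} [f f0|a g f h Gg _ IH hE]; first exact: spn0.
exact: spn_lin (GG' _ Gg) IH hE.
Qed.

Lemma spn_sub_gen G G' f : (forall g, G g -> G' g) -> spn G f -> spn G' f.
Proof. by move=> GG'; apply: spn_trans => g /GG' /spn_gen. Qed.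

End Span.

Section LinOp.
Variables (k : fieldType) (L L' : eqType).

(** The pointwise hypothesis on [h] packs linearity and compatibility with pointwise equality into
    one condition. *)
Definition linop (F : (tree L -> k) -> (tree L' -> k)) :=
  forall a f g h, h =1 (fun t => a * f t + g t) ->
    F h =1 (fun t => a * F f t + F g t).

Lemma spn_map (F : (tree L -> k) -> (tree L' -> k)) (G : (tree L -> k) -> Prop) G' f :
  linop F -> (forall g, G g -> spn G' (F g)) -> spn G f -> spn G' (F f).
Proof.
move=> lF GG'; elim=> {f} [f f0|a g f h Gg _ IH hE].
  apply: spn0 => t; have := lF 0 f f f; rewrite /= => /(_ _ t) ->.
    have e : f =1 (fun t => (-1) * f t + f t) by move=> u; rewrite mulN1r addNr f0.
    by rewrite mul0r add0r; rewrite (lF _ _ _ _ e) mulN1r addNr.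
  by move=> u; rewrite mul0r add0r.
exact: spn_lin (GG' _ Gg) IH (lF _ _ _ _ hE).
Qed.

End LinOp.

Section Linear.
Variables (k : fieldType) (L : eqType) (V : lmodType k) (phi : tree L -> V).

Definition lin (c : comb k L) : V := \sum_(p <- c) p.1 *: phi p.2.

Lemma lin_cat c d : lin (c ++ d) = lin c + lin d.
Proof. by rewrite /lin big_cat. Qed.

Lemma lin_cons p c : lin (p :: c) = p.1 *: phi p.2 + lin c.
Proof. by rewrite /lin big_cons. Qed.

Lemma lin_nil : lin [::] = 0.
Proof. by rewrite /lin big_nil. Qed.

Lemma lin_cscale a c : lin (cscale a c) = a *: lin c.
Proof. by rewrite /lin big_map scaler_sumr; apply: eq_bigr => p _; rewrite scalerA. Qed.

Lemma lin_csub c d : lin (csub c d) = lin c - lin d.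
Proof. by rewrite lin_cat lin_cscale scaleN1r. Qed.

Lemma linE c (s : seq (tree L)) : uniq s -> {subset [seq p.2 | p <- c] <= s} ->
  lin c = \sum_(t <- s) coef c t *: phi t.
Proof.
move=> us; elim: c => [|p c IH] sub.
  by rewrite lin_nil big1_seq // => t _; rewrite coefc_nil scale0r.
rewrite lin_cons IH => [|t tc]; last by apply: sub; rewrite /= inE tc orbT.
under [RHS]eq_bigr => t _ do rewrite coefc_cons scalerDl.
rewrite big_split /=; congr (_ + _).
rewrite (bigD1_seq p.2) ?us //=; last by apply: sub; rewrite /= inE eqxx.
rewrite /single eqxx mulr1 big1 ?addr0 // => t.
by rewrite eq_sym => /negPf->; rewrite mulr0 scale0r.
Qed.

Lemma lin_ext c d : coef c =1 coef d -> lin c = lin d.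
Proof.
move=> cd; pose s := undup ([seq p.2 | p <- c] ++ [seq p.2 | p <- d]).
have us : uniq s by apply: undup_uniq.
rewrite (linE us) => [|t tc]; last by rewrite mem_undup mem_cat tc.
rewrite (linE us) => [|t tc]; last by rewrite mem_undup mem_cat tc orbT.
by apply: eq_bigr => t _; rewrite cd.
Qed.

Lemma lin_span (G : comb k L -> Prop) (P : V -> Prop) v :
  P 0 -> (forall a x y, P x -> P y -> P (a *: x + y)) ->
  (forall g, G g -> P (lin g)) -> in_span G v -> P (lin v).
Proof.
move=> P0 PD PG [gs [Ggs /lin_ext ->]].
elim: gs Ggs => [|p gs IH] Ggs /=; first by rewrite lin_nil.
rewrite lin_cat lin_cscale; apply: PD.
  by apply: PG; apply: Ggs; rewrite inE eqxx.
by apply: IH => q qg; apply: Ggs; rewrite inE qg orbT.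
Qed.

End Linear.

Section Ideal.
Variables (k : fieldType) (L : eqType) (R : seq (comb k L)).
Implicit Types (g c : comb k L) (t u T : tree L).

Definition nodel (a : L) (u : tree L) (g : comb k L) : comb k L :=
  [seq (p.1, Node a p.2 u) | p <- g].
Definition noder (a : L) (u : tree L) (g : comb k L) : comb k L :=
  [seq (p.1, Node a u p.2) | p <- g].

(** The ideal without arity bookkeeping: a relation is pushed through one vertex at a time, which
    gives a usable induction principle. If no relation is empty, this agrees with [ideal_gen] on
    combinations of arity n. *)
Inductive pgen : comb k L -> Prop :=
| pgen_rel r s : r \in R -> pgen (csubst s r)
| pgen_l a u g : pgen g -> pgen (nodel a u g)
| pgen_r a u g : pgen g -> pgen (noder a u g).

Lemma eq_tsubst s1 s2 t : {in leaves t, s1 =1 s2} -> tsubst s1 t = tsubst s2 t.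
Proof.
elim: t => [i|a l IHl r IHr] /= e; first by apply: e; rewrite inE.
by rewrite IHl ?IHr // => i il; apply: e; rewrite mem_cat il ?orbT.
Qed.

Lemma tsubst_Leaf t : tsubst Leaf t = t.
Proof. by elim: t => //= a l -> r ->. Qed.

Lemma leaves_tsubst s t : leaves (tsubst s t) = flatten [seq leaves (s i) | i <- leaves t].
Proof. by elim: t => [i|a l IHl r IHr] /=; rewrite ?cats0 // IHl IHr map_cat flatten_cat. Qed.

Lemma graft_notin T j u : j \notin leaves T ->
  tsubst (fun i => if i == j then u else Leaf i) T = T.
Proof.
move=> jT; rewrite -[RHS]tsubst_Leaf; apply: eq_tsubst => i iT.
by case: eqP => // ij; rewrite -ij iT in jT.
Qed.

Lemma graft_pgen T j c : pgen c -> count_mem j (leaves T) = 1%N -> pgen (graft T j c).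
Proof.
move=> pc; elim: T => [i|a l IHl r IHr] /=.
  case: eqP => //= -> _; rewrite (_ : graft _ _ _ = c) //.
  by rewrite /graft -[RHS]map_id; apply: eq_map => -[x t] /=; rewrite eqxx.
rewrite count_cat => /eqP; rewrite addn_eq1 => /orP[]/andP[/eqP c1 /eqP c2].
  have -> : graft (Node a l r) j c = nodel a r (graft l j c).
    rewrite /graft /nodel -map_comp; apply: eq_map => p /=.
    by rewrite (graft_notin _ (T := r)) // -has_pred1 has_count c2.
  exact/pgen_l/IHl.
have -> : graft (Node a l r) j c = noder a l (graft r j c).
  rewrite /graft /noder -map_comp; apply: eq_map => p /=.
  by rewrite (graft_notin _ (T := l)) // -has_pred1 has_count c1.
exact/pgen_r/IHr.
Qed.

Lemma ideal_gen_pgen n g : ideal_gen R n g -> pgen g.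
Proof. by case=> r [T [j [s [rR cT -> _]]]]; apply: graft_pgen => //; apply: pgen_rel. Qed.

Hypothesis R0 : [::] \notin R.

Lemma pgen_neq0 g : pgen g -> exists p, p \in g.
Proof.
elim=> [r s rR|a u {}g _ [p pg]|a u {}g _ [p pg]].
- by case: r rR R0 => [->|p r _ _] //; exists (p.1, tsubst s p.2); rewrite inE eqxx.
- by exists (p.1, Node a p.2 u); apply/mapP; exists p.
- by exists (p.1, Node a u p.2); apply/mapP; exists p.
Qed.

(* The hole of the context must carry a label that does not occur in g. *)
Lemma pgen_graft g j : pgen g -> (forall p, p \in g -> j \notin leaves p.2) ->
  exists r T s, [/\ r \in R, count_mem j (leaves T) = 1%N & g = graft T j (csubst s r)].
Proof.
elim=> [r s rR|a u {}g pg IH|a u {}g pg IH] jg.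
- exists r, (Leaf j), s; split; rewrite //= ?eqxx //.
  rewrite /graft -[LHS]map_id; apply: eq_map => -[x t] /=.
  by rewrite eqxx.
- have [q qg] := pgen_neq0 pg.
  have ju : j \notin leaves u.
    by have := jg (q.1, Node a q.2 u) (map_f _ qg); rewrite /= mem_cat negb_or => /andP[].
  have [|r [T [s [rR cT ->]]]] := IH.
    move=> p pg'; have := jg (p.1, Node a p.2 u) (map_f _ pg').
    by rewrite /= mem_cat negb_or => /andP[].
  exists r, (Node a T u), s; split=> //=.
    by rewrite count_cat cT (count_memPn ju).
  by rewrite /graft /nodel -map_comp; apply: eq_map => p /=; rewrite (graft_notin _ ju).
- have [q qg] := pgen_neq0 pg.
  have ju : j \notin leaves u.
    by have := jg (q.1, Node a u q.2) (map_f _ qg); rewrite /= mem_cat negb_or => /andP[].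
  have [|r [T [s [rR cT ->]]]] := IH.
    move=> p pg'; have := jg (p.1, Node a u p.2) (map_f _ pg').
    by rewrite /= mem_cat negb_or => /andP[].
  exists r, (Node a u T), s; split=> //=.
    by rewrite count_cat cT (count_memPn ju).
  by rewrite /graft /noder -map_comp; apply: eq_map => p /=; rewrite (graft_notin _ ju).
Qed.

Lemma pgen_ideal_gen n g : pgen g -> all_arity n g -> ideal_gen R n g.
Proof.
(* Labels of an arity-n tree are below n, so n itself is a fresh label for the hole. *)
move=> pg ag; have [|r [T [s [rR cT gE]]]] := @pgen_graft g n pg.
  by move=> p /(allP ag) /perm_mem ->; rewrite mem_iota add0n ltnn andbF.
by exists r, T, n, s.
Qed.

Hypothesis Rl : forall r, r \in R -> {in r &, forall p q, perm_eq (leaves p.2) (leaves q.2)}.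

Lemma pgen_leaves g : pgen g -> {in g &, forall p q, perm_eq (leaves p.2) (leaves q.2)}.
Proof.
elim=> [r s rR|a u {}g pg IH|a u {}g pg IH] p q /mapP[p' pg' ->] /mapP[q' qg' ->] /=.
- rewrite !leaves_tsubst; apply: perm_flatten; apply: perm_map; exact: (Rl rR pg' qg').
- by rewrite perm_cat2r; apply: (IH p' q').
- by rewrite perm_cat2l; apply: (IH p' q').
Qed.

End Ideal.

Section Project.
Variables (k : fieldType) (L : eqType).

Lemma coef_filter (A : pred (tree L)) (c : comb k L) t :
  coef [seq p <- c | A p.2] t = (A t)%:R * coef c t.
Proof.
elim: c => [|p c IH] /=; first by rewrite !coefcE mulr0.
rewrite coefc_cons mulrDr -IH.
have [e|ne] := eqVneq p.2 t.
  by rewrite -e; case: (A p.2); rewrite ?coefc_cons /single ?eqxx ?mul1r ?mul0r ?add0r // mulr1.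
have -> : single k p.2 t = 0 by rewrite /single (negPf ne).
by rewrite !mulr0 add0r; case: (A p.2); rewrite // coefc_cons /single (negPf ne) mulr0 add0r.
Qed.

(** Each generator lies wholly inside or wholly outside [A], so projecting onto the trees in [A]
    fixes it or kills it. Arity and bracket degree are imposed on spans in this way. *)
Lemma in_span_filter (A : pred (tree L)) (G : comb k L -> Prop) v :
  (forall g, G g -> {in g &, forall p q, A p.2 = A q.2}) ->
  in_span G v -> in_span (fun g => G g /\ all (fun p => A p.2) g) [seq p <- v | A p.2].
Proof.
move=> GA /in_spanE sv; apply/in_spanE.
apply: (@spn_ext _ _ _ (fun t => (A t)%:R * coef v t)) => [t|]; first exact: coef_filter.
apply: (@spn_map _ _ _ (fun f t => (A t)%:R * f t) _ _ (coef v) _ _ sv) => [a f g h hE t|].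
  by rewrite /= hE; ring.
move=> g [c Gc gE].
have [Ac|nAc] := boolP (all (fun p => A p.2) c).
  apply: spn_gen; exists c => // t; rewrite gE -coef_filter; congr (coef _ t).
  exact/all_filterP.
apply: spn0 => t; rewrite gE -coef_filter.
suff -> : [seq p <- c | A p.2] = [::] by rewrite coefc_nil.
apply/eqP; rewrite -size_eq0 size_filter -leqn0 leqNgt -has_count.
apply: contra nAc => /hasP[p pc Ap]; apply/allP => q qc; by rewrite (GA _ Gc q p).
Qed.

Lemma in_span_all (A : pred (tree L)) (G : comb k L -> Prop) v :
  (forall g, G g -> {in g &, forall p q, A p.2 = A q.2}) -> all (fun p => A p.2) v ->
  in_span G v -> in_span (fun g => G g /\ all (fun p => A p.2) g) v.
Proof. by move=> GA /all_filterP {2}<-; apply: in_span_filter. Qed.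

Lemma in_span_sub (G G' : comb k L -> Prop) v :
  (forall g, G g -> G' g) -> in_span G v -> in_span G' v.
Proof. by move=> GG' [gs [Ggs vE]]; exists gs; split=> // p /Ggs /GG'. Qed.

End Project.

(** * The Lie filtration of PreLie *)

Section Evaluation.
Variable k : fieldType.
Local Notation fn := (tree unit -> k).
Implicit Types (f g h : fn).

(** The bilinear extension of the magma product: a tree splits in only one way into two branches, so
    the convolution sum has a single term. *)
Definition dotf f g : fn :=
  fun t => if t is Node _ l r then f l * g r else 0.

Definition symf (b : bool) f g : fn :=
  fun t => dotf f g t + (if b then -1 else 1) * dotf g f t.

Definition evf (t : tree bool) : fn := coef (ev k t).

Lemma evf_leaf i : evf (Leaf i) =1 single k (Leaf i).
Proof. by move=> t; rewrite /evf /= coefc_cons coefc_nil mul1r addr0. Qed.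

Lemma single_node (l r : tree unit) : single k (Node tt l r) =1 dotf (single k l) (single k r).
Proof.
move=> [i|[] l' r'] //=; rewrite /single -natrM mulnb; congr (_ %:R).
Qed.

Lemma coef_dots (s : k) (c d : comb k unit) :
  coef (flatten [seq flatten [seq [:: (p.1 * q.1, Node tt p.2 q.2);
                                      (s * (p.1 * q.1), Node tt q.2 p.2)]
                             | q <- d] | p <- c]) =1
  (fun t => dotf (coef c) (coef d) t + s * dotf (coef d) (coef c) t).
Proof.
move=> t; elim: c => [|p c IH] /=.
  by case: t => [i|a l r] /=; rewrite !coefcE ?mul0r ?mulr0 addr0.
rewrite coefc_cat {}IH; set X := coef (flatten _) t.
suff -> : X = p.1 * dotf (single k p.2) (coef d) t + s * (p.1 * dotf (coef d) (single k p.2) t).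
  by case: t {X} => [i|a l r] /=; rewrite ?coefc_cons; ring.
rewrite {}/X; elim: d => [|q d IH] /=.
  by case: t => [i|a l r] /=; rewrite !coefcE ?mul0r ?mulr0 addr0.
rewrite 2!coefc_cons {}IH /= !single_node.
by case: t => [i|a l r] /=; rewrite ?coefc_cons; ring.
Qed.

Lemma evf_node b l r : evf (Node b l r) =1 symf b (evf l) (evf r).
Proof. exact: coef_dots. Qed.

Lemma dotf_linl f : linop (dotf^~ f).
Proof. by move=> a g h m mE [i|[] l r] /=; rewrite ?mE; ring. Qed.

Lemma dotf_linr f : linop (dotf f).
Proof. by move=> a g h m mE [i|[] l r] /=; rewrite ?mE; ring. Qed.

Lemma symf_linl b f : linop (symf b ^~ f).
Proof. by move=> a g h m mE [i|[] l r]; rewrite /symf /= ?mE; ring. Qed.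

Lemma dotf_ext f f' g g' : f =1 f' -> g =1 g' -> dotf f g =1 dotf f' g'.
Proof. by move=> ff gg [i|a l r] //=; rewrite ff gg. Qed.

Lemma symf_ext b f f' g g' : f =1 f' -> g =1 g' -> symf b f g =1 symf b f' g'.
Proof. by move=> ff gg t; rewrite /symf (dotf_ext ff gg) (dotf_ext gg ff). Qed.

Lemma coef_nodel (u : tree unit) (c : comb k unit) :
  coef (nodel tt u c) =1 dotf (coef c) (single k u).
Proof.
elim: c => [|p c IH] t /=; first by case: t => [i|a l r]; rewrite /= !coefcE ?mul0r.
rewrite coefc_cons IH /= single_node.
by case: t => [i|a l r] /=; rewrite ?coefc_cons; ring.
Qed.

Lemma coef_noder (u : tree unit) (c : comb k unit) :
  coef (noder tt u c) =1 dotf (single k u) (coef c).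
Proof.
elim: c => [|p c IH] t /=; first by case: t => [i|a l r]; rewrite /= !coefcE ?mulr0.
rewrite coefc_cons IH /= single_node.
by case: t => [i|a l r] /=; rewrite ?coefc_cons; ring.
Qed.

(** The finitely supported functions. Spans contain finite combinations only, so multiplying an
    ideal element by [g] is controlled by expanding [g] into finitely many trees. *)
Definition fs : fn -> Prop := spn (fun g => exists t, g =1 single k t).

Lemma fs_single (t : tree unit) : fs (single k t).
Proof. by apply: spn_gen; exists t. Qed.

Lemma fs_coef c : fs (coef c).
Proof.
elim: c => [|p c IH]; first by apply: spn0 => t; rewrite coefc_nil.
by apply: (spn_lin (fs_single p.2) IH) => t; rewrite coefc_cons.
Qed.

Definition PLc : fn -> Prop := spn (fun f => exists2 c, pgen (prelie_rels k) c & f =1 coef c).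

Lemma PLc_dotl f g : PLc f -> fs g -> PLc (dotf f g).
Proof.
move=> pf fg; apply: (spn_map (dotf_linr f) _ fg) => u [t ut].
apply: (spn_map (dotf_linl u) _ pf) => _f [c pc fE].
apply: spn_gen; exists (nodel tt t c); first exact: pgen_l.
by move=> v; rewrite coef_nodel; apply: dotf_ext.
Qed.

Lemma PLc_dotr f g : PLc f -> fs g -> PLc (dotf g f).
Proof.
move=> pf fg; apply: (spn_map (dotf_linl f) _ fg) => u [t ut].
apply: (spn_map (dotf_linr u) _ pf) => _f [c pc fE].
apply: spn_gen; exists (noder tt t c); first exact: pgen_r.
by move=> v; rewrite coef_noder; apply: dotf_ext.
Qed.

Definition asc f g h : fn :=
  fun t => dotf (dotf f g) h t - dotf f (dotf g h) t -
           dotf (dotf f h) g t + dotf f (dotf h g) t.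

(** Trilinearity of [asc] reduces the claim to three single trees, where it is a substitution
    instance of the defining relation. *)
Lemma PLc_asc f g h : fs f -> fs g -> fs h -> PLc (asc f g h).
Proof.
move=> ff fg fh.
apply: (@spn_map _ _ _ (asc^~ g ^~ h) _ _ f _ _ ff) => [|f' [t ft]].
  by move=> a u v w wE [i|b [j|b' l' r'] [j'|b'' l'' r'']]; rewrite /asc /= ?wE; ring.
apply: (@spn_map _ _ _ (asc f' ^~ h) _ _ g _ _ fg) => [|g' [u gu]].
  by move=> a x v w wE [i|b [j|b' l' r'] [j'|b'' l'' r'']]; rewrite /asc /= ?wE; ring.
apply: (@spn_map _ _ _ (asc f' g') _ _ h _ _ fh) => [|h' [v hv]].
  by move=> a x y w wE [i|b [j|b' l' r'] [j'|b'' l'' r'']]; rewrite /asc /= ?wE; ring.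
pose s i : tree unit := nth t [:: t; u; v] i.
apply: spn_gen; exists (csubst s (head [::] (prelie_rels k))).
  by apply: pgen_rel; rewrite inE.
move=> w; rewrite /= !coefc_cons coefc_nil /asc !single_node.
have e f1 f2 f3 : f1 =1 single k t -> f2 =1 single k u -> f3 =1 single k v ->
  (dotf (dotf f1 f2) f3 w = dotf (single k (Node tt t u)) (single k v) w) *
  (dotf f1 (dotf f2 f3) w = dotf (single k t) (single k (Node tt u v)) w).
  move=> e1 e2 e3; split; apply: dotf_ext => // x; rewrite ?e1 ?e3 // single_node;
    exact: dotf_ext.
rewrite !(e _ _ _ ft gu hv).
have -> : dotf (dotf f' h') g' w = dotf (single k (Node tt t v)) (single k u) w.
  by apply: dotf_ext => // x; rewrite single_node; apply: dotf_ext.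
have -> : dotf f' (dotf h' g') w = dotf (single k t) (single k (Node tt v u)) w.
  by apply: dotf_ext => // x; rewrite single_node; apply: dotf_ext.
by rewrite /s /=; ring.
Qed.

(** The preimage of F^j in the free magmatic operad, for all arities at once; [GF_Fgen] restores the
    arity. *)
Definition GF (j : nat) : fn -> Prop :=
  spn (fun f => (exists2 c, pgen (prelie_rels k) c & f =1 coef c) \/
                (exists2 t, (j <= nbrk t)%N & f =1 evf t)).

Lemma GF_PLc j f : PLc f -> GF j f.
Proof. by apply: spn_sub_gen => g; left. Qed.

Lemma GF_asc j f g h : fs f -> fs g -> fs h -> GF j (asc f g h).
Proof. by move=> ff fg fh; apply/GF_PLc/PLc_asc. Qed.

Lemma GF_dotl j f g h : fs f -> fs g -> fs h -> forall m, fs m -> GF j (dotf (asc f g h) m).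
Proof. by move=> ff fg fh m fm; apply/GF_PLc/PLc_dotl => //; apply: PLc_asc. Qed.

Lemma GF_evf j t : (j <= nbrk t)%N -> GF j (evf t).
Proof. by move=> jt; apply: spn_gen; right; exists t. Qed.

Lemma GF_symfl j (b : bool) f u : GF j f -> GF (j + b + nbrk u) (symf b f (evf u)).
Proof.
move=> gf; apply: (spn_map (symf_linl b _) _ gf) => {gf f} f [[c pc fE]|[t jt fE]].
  have pf : PLc f by apply: spn_gen; exists c.
  apply: GF_PLc; apply: (@spn_lin _ _ _ (if b then -1 else 1) (dotf (evf u) f) (dotf f (evf u))).
  - exact/PLc_dotr/fs_coef.
  - exact/PLc_dotl/fs_coef.
  - by move=> v; rewrite addrC.
apply: (@spn_ext _ _ _ (evf (Node b t u))); last by apply: GF_evf => /=; lia.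
by move=> v; rewrite evf_node; apply: symf_ext.
Qed.

Lemma symfC b f g t : symf b f g t = (if b then -1 else 1) * symf b g f t.
Proof. by rewrite /symf; case: b; ring. Qed.

Lemma GF_symfr j (b : bool) f u : GF j f -> GF (j + b + nbrk u) (symf b (evf u) f).
Proof. by move=> gf; apply: (spn_scale (GF_symfl b u gf)) => t; apply: symfC. Qed.

Lemma coef_ev_cons p (x : comb k bool) :
  coef (ev_comb (p :: x)) =1 (fun t => p.1 * evf p.2 t + coef (ev_comb x) t).
Proof. by move=> t; rewrite /ev_comb /= coefc_cat coef_cscale. Qed.

Lemma coef_ev_nil : coef (@ev_comb k [::]) =1 (fun=> 0).
Proof. by move=> t; rewrite coefc_nil. Qed.

Lemma coef_ev_nodel b u (x : comb k bool) :
  coef (ev_comb (nodel b u x)) =1 symf b (coef (ev_comb x)) (evf u).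
Proof.
elim: x => [|p x IH] t.
  by case: t => [i|a l r]; rewrite /symf /= !coef_ev_nil; ring.
rewrite coef_ev_cons IH /= evf_node.
by case: t => [i|a l r]; rewrite /symf /= ?coef_ev_cons; ring.
Qed.

Lemma coef_ev_noder b u (x : comb k bool) :
  coef (ev_comb (noder b u x)) =1 symf b (evf u) (coef (ev_comb x)).
Proof.
elim: x => [|p x IH] t.
  by case: t => [i|a l r]; rewrite /symf /= !coef_ev_nil; ring.
rewrite coef_ev_cons IH /= evf_node.
by case: t => [i|a l r]; rewrite /symf /= ?coef_ev_cons; ring.
Qed.

End Evaluation.

(** * The FMan relations in the associated graded of PreLie *)

Section Relations.
Variable k : fieldType.
Local Notation fn := (tree unit -> k).
Local Notation X := (@Leaf bool).

Fixpoint evp (F : nat -> fn) (t : tree bool) : fn :=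
  match t with Leaf i => F i | Node b l r => symf b (evp F l) (evp F r) end.

Lemma evf_tsubst s t : evf k (tsubst s t) =1 evp (fun i => evf k (s i)) t.
Proof.
by elim: t => [i|b l IHl r IHr] //= u; rewrite evf_node; apply: symf_ext.
Qed.

Lemma fs_evp s t : fs (evp (fun i => evf k (s i)) t).
Proof.
apply: (@spn_ext _ _ _ (evf k (tsubst s t))); last exact: fs_coef.
by move=> u; rewrite evf_tsubst.
Qed.

Lemma coef_ev_csubst s (c : comb k bool) :
  coef (ev_comb (csubst s c)) =1 lincombf [seq (p.1, evp (fun i => evf k (s i)) p.2) | p <- c].
Proof.
elim: c => [|p c IH] t /=; first by rewrite coef_ev_nil.
by rewrite coef_ev_cons IH /= evf_tsubst.
Qed.

(** An explicit membership witness: [w] lists tree tensors with enough brackets, [a] pre-Lie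
    relators, and [d] pre-Lie relators multiplied on the right by one more tree. The last two lie in
    the PreLie ideal, so only the bracket counts in [w] remain to be checked. *)
Definition certificate (F : nat -> fn) (w : comb k bool)
    (a : seq (k * (tree bool * tree bool * tree bool)))
    (d : seq (k * (tree bool * tree bool * tree bool) * tree bool)) : fn :=
  lincombf ([seq (p.1, evp F p.2) | p <- w] ++
      [seq (p.1, asc (evp F p.2.1.1) (evp F p.2.1.2) (evp F p.2.2)) | p <- a] ++
      [seq (p.1.1, dotf (asc (evp F p.1.2.1.1) (evp F p.1.2.1.2) (evp F p.1.2.2))
                        (evp F p.2)) | p <- d]).

Lemma AllP_cat (T : Type) (P : T -> Prop) s1 s2 : AllP P s1 -> AllP P s2 -> AllP P (s1 ++ s2).
Proof. by elim: s1 => //= x s1 IH [Px Ps1] /(IH Ps1). Qed.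

Lemma AllP_map (T T' : Type) (f : T -> T') (P : T' -> Prop) s :
  (forall x, P (f x)) -> AllP P (map f s).
Proof. by move=> Pf; elim: s. Qed.

Lemma GF_certificate j s w a d (f : fn) :
  AllP (fun p => (j <= nbrk (tsubst s p.2))%N) w ->
  f =1 certificate (fun i => evf k (s i)) w a d -> GF j f.
Proof.
move=> jw; apply: spn_lincombf; apply: AllP_cat; last apply: AllP_cat.
- elim: w jw => //= p w IH [jp /IH jw]; split=> //.
  apply: (spn_ext _ (GF_evf k jp)) => t; by rewrite evf_tsubst.
- by apply: AllP_map => p; apply: GF_asc; apply: fs_evp.
- by apply: AllP_map => p; apply: GF_dotl; apply: fs_evp.
Qed.

Ltac fnring := rewrite /certificate /= /symf /asc /dotf => t /=;
  repeat match goal with |- context [match ?u with Leaf _ => _ | Node _ _ _ => _ end] =>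
     is_var u; case: u => [?|? ? ?] /= end; ring.

(* The coefficients in the three certificates below were found by solving the
   linear system over the rationals. *)
Lemma assoc_certificate F :
  lincombf [seq (p.1, evp F p.2) | p <- [:: (1, o (o (X 0) (X 1)) (X 2)); (-1, o (X 0) (o (X 1) (X 2)))]]
  =1 certificate F
    [:: (1, o (X 0) (br (X 1) (X 2))); (-1, br (X 0) (br (X 1) (X 2)));
        (-1, br (X 0) (o (X 1) (X 2))); (1, o (br (X 0) (X 1)) (X 2));
        (1, br (br (X 0) (X 1)) (X 2)); (-1, br (o (X 0) (X 1)) (X 2));
        (2, o (br (X 0) (X 2)) (X 1)); (-2, br (br (X 0) (X 2)) (X 1))]
    [:: (4, (X 1, X 0, X 2))] [::].
Proof. fnring. Qed.

Lemma jacobi_certificate F :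
  lincombf [seq (p.1, evp F p.2) | p <- [:: (1, br (br (X 0) (X 1)) (X 2)); (1, br (br (X 1) (X 2)) (X 0));
          (1, br (br (X 2) (X 0)) (X 1))]]
  =1 certificate F [::]
    [:: (1, (X 0, X 1, X 2)); (-1, (X 1, X 0, X 2)); (1, (X 2, X 0, X 1))] [::].
Proof. fnring. Qed.

Lemma hertling_manin_certificate F :
  lincombf [seq (p.1, evp F p.2) | p <- nth [::] (fman_rels k) 4]
  =1 certificate F
   [:: (1, br (br (X 0) (X 2)) (o (X 1) (X 3))); (-2, o (X 0) (br (br (X 1) (X 3)) (X 2)));
       (1, br (br (X 0) (X 3)) (o (X 1) (X 2))); (-1, br (o (X 0) (X 3)) (br (X 1) (X 2)));
       (-1, br (o (X 0) (X 2)) (br (X 1) (X 3))); (2, o (br (X 0) (br (X 1) (X 3))) (X 2));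
       (-2, o (br (br (X 0) (X 3)) (X 2)) (X 1)); (2, br (br (br (X 0) (X 3)) (X 2)) (X 1));
       (2, o (br (X 0) (br (X 1) (X 2))) (X 3)); (-2, br (br (X 0) (br (X 1) (X 2))) (X 3));
       (-1, o (X 0) (br (X 1) (br (X 2) (X 3)))); (-1, o (br (X 0) (br (X 2) (X 3))) (X 1));
       (2, br (br (X 0) (X 3)) (br (X 1) (X 2))); (1, br (X 0) (br (X 1) (br (X 2) (X 3))));
       (1, br (br (X 0) (br (X 2) (X 3))) (X 1)); (-1, o (br (br (X 0) (X 1)) (X 3)) (X 2));
       (-1, o (br (br (X 0) (X 1)) (X 2)) (X 3))]
   [:: (1, (o (X 2) (X 3), X 0, X 1)); (-1, (X 1, o (X 2) (X 3), X 0));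
       (-2, (X 2, br (X 1) (X 3), X 0)); (-4, (X 1, br (X 0) (X 3), X 2));
       (-1, (X 0, o (X 2) (X 3), X 1)); (1, (X 3, o (X 0) (X 1), X 2));
       (-2, (X 0, br (X 1) (X 3), X 2)); (2, (X 1, br (X 2) (X 3), X 0));
       (-2, (o (X 1) (X 3), X 0, X 2)); (-4, (X 3, br (X 1) (X 2), X 0));
       (1, (X 2, o (X 0) (X 1), X 3)); (-1, (o (X 0) (X 1), X 2, X 3));
       (1, (br (X 0) (X 1), X 2, X 3)); (-1, (X 3, br (X 0) (X 1), X 2));
       (-1, (X 2, br (X 0) (X 1), X 3))]
   [:: (-4, (X 1, X 0, X 3), X 2); (-4, (X 3, X 1, X 2), X 0)].
Proof. fnring. Qed.

End Relations.

Section Homogeneity.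
Variable k : fieldType.
Lemma nbrk_tsubst s (t : tree bool) :
  nbrk (tsubst s t) = (nbrk t + \sum_(i <- leaves t) nbrk (s i))%N.
Proof.
elim: t => [i|b l IHl r IHr] /=; first by rewrite big_seq1.
by rewrite IHl IHr big_cat /=; lia.
Qed.

Lemma fman_rels_homogeneous r : r \in fman_rels k ->
  {in r &, forall p q, perm_eq (leaves p.2) (leaves q.2) /\ nbrk p.2 = nbrk q.2}.
Proof.
move=> rR p q pr qr.
have : all (fun r => all (fun p => all (fun q =>
    perm_eq (leaves p.2) (leaves q.2) && (nbrk p.2 == nbrk q.2)) r) r) (fman_rels k) by [].
by move=> /allP/(_ _ rR)/allP/(_ _ pr)/allP/(_ _ qr)/andP[-> /eqP].
Qed.

Lemma nbrk_fman_rel r s : r \in fman_rels k ->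
  {in r &, forall p q, nbrk (tsubst s p.2) = nbrk (tsubst s q.2)}.
Proof.
move=> rR p q pr qr; have [pl pn] := fman_rels_homogeneous rR pr qr.
by rewrite !nbrk_tsubst pn (perm_big _ pl).
Qed.

Lemma pgen_fman_nbrk g : pgen (fman_rels k) g -> {in g &, forall p q, nbrk p.2 = nbrk q.2}.
Proof.
elim=> [r s rR|a u {}g pg IH|a u {}g pg IH] p q /mapP[p' pg' ->] /mapP[q' qg' ->] /=.
- exact: (nbrk_fman_rel s rR pg' qg').
- by rewrite (IH _ _ pg' qg').
- by rewrite (IH _ _ pg' qg').
Qed.

Lemma pgen_fman_leaves g :
  pgen (fman_rels k) g -> {in g &, forall p q, perm_eq (leaves p.2) (leaves q.2)}.
Proof.
apply: pgen_leaves => r rR p q pr qr.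
by case: (fman_rels_homogeneous rR pr qr).
Qed.

Lemma GF_fman_rel r s p :
  r \in fman_rels k -> p \in csubst s r -> GF (nbrk p.2).+1 (coef (ev_comb (csubst s r))).
Proof.
move=> rR.
suff main : forall j, {in r, forall p, nbrk (tsubst s p.2) = j} ->
    GF j.+1 (coef (ev_comb (csubst s r))).
  by case/mapP=> q qr -> /=; apply: main => q' q'r; apply: (nbrk_fman_rel s rR).
move=> j; move: rR; rewrite !inE => rR hj.
have {hj} : AllP (fun p => nbrk (tsubst s p.2) = j) r.
  elim: (r) hj => //= q r' IH h; split; first by rewrite h // mem_head.
  by apply: IH => q' q'r'; rewrite h // inE q'r' orbT.
move=> hj; suff : GF j.+1 (lincombf [seq (p.1, evp (fun i => evf k (s i)) p.2) | p <- r]).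
  exact: spn_ext (coef_ev_csubst s r).
move: rR hj; case/or4P=> [/eqP->|/eqP->|/eqP->|/orP[] /eqP->] hj; rewrite /= in hj.
(* The two symmetry relations hold identically once the operations are evaluated. *)
- by apply: spn0 => t /=; rewrite [symf _ (evf _ (s 1%N)) _ _]symfC; ring.
- by apply: spn0 => t /=; rewrite [symf _ (evf _ (s 1%N)) _ _]symfC; ring.
- by apply: GF_certificate (assoc_certificate _) => /=; lia.
(* The Jacobi certificate contains no tree tensors: the identity holds exactly in PreLie, with no
   higher-order correction. *)
- by apply: GF_certificate (jacobi_certificate _).
- by apply: GF_certificate (hertling_manin_certificate _) => /=; lia.
Qed.

(** This makes FMan -> gr_F PreLie well defined. The gain of one filtration step, present for the
    relations, survives in any context because the context adds the same number of brackets to both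
    sides. *)
Lemma GF_fman g p : pgen (fman_rels k) g -> p \in g -> GF (nbrk p.2).+1 (coef (ev_comb g)).
Proof.
move=> pg; elim: pg p => [r s rR|a u {}g pg IH|a u {}g pg IH] p.
- exact: GF_fman_rel.
- case/mapP=> q qg -> /=; apply: spn_ext; first exact: coef_ev_nodel.
  by rewrite (_ : (a + nbrk q.2 + nbrk u).+1 = (nbrk q.2).+1 + a + nbrk u)%N;
    [apply/GF_symfl/IH|lia].
- case/mapP=> q qg -> /=; apply: spn_ext; first exact: coef_ev_noder.
  by rewrite (_ : (a + nbrk u + nbrk q.2).+1 = (nbrk q.2).+1 + a + nbrk u)%N;
    [apply/GF_symfr/IH|lia].
Qed.

End Homogeneity.

(** * Normal forms in FMan *)

Inductive rose := Rose of nat & seq rose.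

Section RoseInduction.
Variable P : rose -> Prop.
Hypothesis PRose : forall x rs, AllP P rs -> P (Rose x rs).

Fixpoint rose_AllP_ind (r : rose) : P r :=
  let: Rose x rs := r in
  PRose x ((fix rec (s : seq rose) : AllP P s :=
    if s is r' :: s' then conj (rose_AllP_ind r') (rec s') else I) rs).

End RoseInduction.

Fixpoint rose_code (r : rose) : GenTree.tree unit :=
  let: Rose x rs := r in GenTree.Node x [seq rose_code r' | r' <- rs].

Fixpoint rose_decode (t : GenTree.tree unit) : rose :=
  if t is GenTree.Node x ts then Rose x [seq rose_decode t' | t' <- ts] else Rose 0 [::].

Lemma rose_codeK : cancel rose_code rose_decode.
Proof.
elim/rose_AllP_ind => x rs IH /=; congr Rose; rewrite -map_comp.
by elim: rs IH => //= r rs IHrs [-> /IHrs ->].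
Qed.

HB.instance Definition _ := Equality.copy rose (can_type rose_codeK).

Lemma rose_ind' (P : rose -> Prop) :
  (forall x rs, {in rs, forall r, P r} -> P (Rose x rs)) -> forall r, P r.
Proof.
move=> PRose; elim/rose_AllP_ind => x rs IH; apply: PRose => r.
by elim: rs IH => //= r' rs IHrs [Pr /IHrs Prs]; rewrite inE => /predU1P[->|/Prs].
Qed.

Definition root r := let: Rose x _ := r in x.

Fixpoint labels r : seq nat :=
  let: Rose x rs := r in x :: flatten [seq labels r' | r' <- rs].

(** Selects one planar representative of each rooted tree. *)
Fixpoint canon r : bool :=
  let: Rose x rs := r in sorted ltn [seq root r' | r' <- rs] && all canon rs.

Fixpoint isN r : bool :=
  let: Rose x rs := r in all (fun r' => isN r' ==> (x < root r')%N) rs.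

Definition good x r := isN r ==> (x < root r)%N.

Lemma isN_Rose x rs : isN (Rose x rs) = all (good x) rs.
Proof. by []. Qed.


Definition adj_word (t : tree bool) (ts : seq (tree bool)) := foldr (fun u acc => br acc u) t ts.
Definition pr (t : tree bool) (ts : seq (tree bool)) := foldr (fun u acc => o acc u) t ts.

(* The tree x(r_1, .., r_m) stands for the product of [..[x, r_i], ..], taken over the good
   children, with the remaining children, which are non-products with root below x;
   isN says that there are none of the latter. *)
Fixpoint om r : tree bool :=
  let: Rose x rs := r in
  foldr (fun r' acc => if isN r' ==> (x < root r')%N then acc else o acc (om r'))
    (foldr (fun r' acc => if isN r' ==> (x < root r')%N then br acc (om r') else acc)
       (Leaf x) rs) rs.

Lemma omE x rs : om (Rose x rs) =
  pr (adj_word (Leaf x) [seq om r | r <- rs & good x r]) [seq om r | r <- rs & ~~ good x r].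
Proof.
rewrite /=.
have -> : forall t, foldr (fun r' acc => if isN r' ==> (x < root r')%N then br acc (om r') else acc) t rs
    = adj_word t [seq om r | r <- rs & good x r].
  by move=> t; elim: rs => //= r rs ->; rewrite /good; case: ifP.
move: (adj_word _ _) => t.
by elim: rs => //= r rs ->; rewrite /good; case: ifP.
Qed.

Ltac countlia := clear; unfold reverse_coercion; lia.

Lemma perm_leaves_ad t ts :
  perm_eq (leaves (adj_word t ts)) (leaves t ++ flatten [seq leaves u | u <- ts]).
Proof.
elim: ts => [|u ts IH] /=; first by rewrite cats0.
move/seq.permP: IH => IH; apply/seq.permP => a; rewrite !count_cat IH count_cat; countlia.
Qed.

Lemma perm_leaves_pr t ts : perm_eq (leaves (pr t ts)) (leaves t ++ flatten [seq leaves u | u <- ts]).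
Proof.
elim: ts => [|u ts IH] /=; first by rewrite cats0.
move/seq.permP: IH => IH; apply/seq.permP => a; rewrite !count_cat IH count_cat; countlia.
Qed.

Lemma perm_leaves_om r : perm_eq (leaves (om r)) (labels r).
Proof.
elim/rose_ind': r => x rs IH; rewrite omE; apply: perm_trans (perm_leaves_pr _ _) _.
apply/seq.permP => a; rewrite count_cat; have /seq.permP -> := perm_leaves_ad (Leaf x) [seq om r | r <- rs & good x r].
rewrite [labels _]/= -cat1s !count_cat -addnA; congr (_ + _)%N.
elim: rs IH => //= r rs IHrs IH.
have /seq.permP er : perm_eq (leaves (om r)) (labels r) by apply: IH; rewrite mem_head.
have {IHrs}IHrs := IHrs (fun r' h => IH r' (mem_behead (s := r :: rs) h)).
by rewrite count_cat -er -IHrs; case: (good x r) => /=; rewrite count_cat; countlia.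
Qed.

(** Adjacent transpositions generate all permutations. The prefix is carried along as an
    accumulator, so that [Q] is always applied to whole lists. *)
Lemma perm_swap_ind (T : eqType) (Q : seq T -> Prop) s t :
  (forall pre a b rest, Q (pre ++ a :: b :: rest) -> Q (pre ++ b :: a :: rest)) ->
  perm_eq s t -> Q s -> Q t.
Proof.
move=> sw; rewrite -[s]cat0s -[t]cat0s perm_cat2l.
elim: s [::] t => [|a s IH] pre t.
  by move/perm_size/esym/size0nil => ->.
move=> pst Qs; have at_ : a \in t by rewrite -(perm_mem pst) mem_head.
case/splitPr: at_ pst => t1 t2; rewrite perm_sym -cat1s perm_catCA perm_cons => pst.
have {Qs} : Q (pre ++ a :: t1 ++ t2).
  by rewrite -cat_rcons; apply: IH; rewrite 1?perm_sym // cat_rcons.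
elim: t1 pre {pst IH} => //= b t1 IHt pre Qs.
by rewrite -cat_rcons; apply: IHt; rewrite cat_rcons; apply: sw.
Qed.

(** * Rewriting modulo the FMan ideal *)

Section SpanFMan.
Variable k : fieldType.
Implicit Types (P Q : tree bool -> Prop) (t u v a b c : tree bool).

(** Working modulo the ideal is expressed by adjoining the ideal to the generators of the span. *)
Definition sp P : (tree bool -> k) -> Prop :=
  spn (fun g => (exists2 c, pgen (fman_rels k) c & g =1 coef c) \/
                (exists2 t, P t & g =1 single k t)).
Definition spt P t := sp P (single k t).

Lemma spt_in P t : P t -> spt P t.
Proof. by move=> Pt; apply: spn_gen; right; exists t. Qed.

Lemma sp_trans P Q f : (forall t, P t -> spt Q t) -> sp P f -> sp Q f.
Proof.
move=> PQ; apply: spn_trans => g [Jg|[t Pt gE]]; first by apply: spn_gen; left.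
exact: spn_ext gE (PQ _ Pt).
Qed.

Lemma spt_trans P Q t : (forall t, P t -> spt Q t) -> spt P t -> spt Q t.
Proof. exact: sp_trans. Qed.

Lemma spt_sub P Q t : (forall t, P t -> Q t) -> spt P t -> spt Q t.
Proof. by move=> PQ; apply: spt_trans => u /PQ /spt_in. Qed.

Definition nodef (x : bool) (f g : tree bool -> k) : tree bool -> k :=
  fun t => if t is Node y l r then (x == y)%:R * (f l * g r) else 0.

Lemma single_nodef x l r : single k (Node x l r) =1 nodef x (single k l) (single k r).
Proof.
move=> [i|y l' r'] //=; rewrite /single -!natrM !mulnb; congr (_ %:R).
Qed.

Lemma nodef_ext x f f' g g' : f =1 f' -> g =1 g' -> nodef x f g =1 nodef x f' g'.
Proof. by move=> ff gg [i|y l r] //=; rewrite ff gg. Qed.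

Lemma coef_nodelf x u (c : comb k bool) :
  coef (nodel x u c) =1 nodef x (coef c) (single k u).
Proof.
elim: c => [|p c IH] t /=; first by case: t => [i|y l r]; rewrite /= !coefcE ?mul0r ?mulr0.
rewrite coefc_cons IH /= single_nodef.
by case: t => [i|y l r] /=; rewrite ?coefc_cons; ring.
Qed.

Lemma coef_noderf x u (c : comb k bool) :
  coef (noder x u c) =1 nodef x (single k u) (coef c).
Proof.
elim: c => [|p c IH] t /=; first by case: t => [i|y l r]; rewrite /= !coefcE ?mulr0.
rewrite coefc_cons IH /= single_nodef.
by case: t => [i|y l r] /=; rewrite ?coefc_cons; ring.
Qed.

Lemma spt_nodel P Q x t u :
  spt P t -> (forall p, P p -> spt Q (Node x p u)) -> spt Q (Node x t u).
Proof.
move=> sP PQ; apply: spn_ext; first exact: single_nodef.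
apply: (@spn_map _ _ _ (nodef x ^~ (single k u)) _ _ _ _ _ sP).
  by move=> a f g h hE [i|y l r] /=; rewrite ?hE; ring.
move=> g [[c pc gE]|[p Pp gE]].
  apply: spn_gen; left; exists (nodel x u c); first exact: pgen_l.
  by move=> v; rewrite coef_nodelf; apply: nodef_ext.
apply: spn_ext (PQ _ Pp) => v; rewrite single_nodef; exact: nodef_ext.
Qed.

Lemma spt_noder P Q x t u :
  spt P t -> (forall p, P p -> spt Q (Node x u p)) -> spt Q (Node x u t).
Proof.
move=> sP PQ; apply: spn_ext; first exact: single_nodef.
apply: (@spn_map _ _ _ (nodef x (single k u)) _ _ _ _ _ sP).
  by move=> a f g h hE [i|y l r] /=; rewrite ?hE; ring.
move=> g [[c pc gE]|[p Pp gE]].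
  apply: spn_gen; left; exists (noder x u c); first exact: pgen_r.
  by move=> v; rewrite coef_noderf; apply: nodef_ext.
apply: spn_ext (PQ _ Pp) => v; rewrite single_nodef; exact: nodef_ext.
Qed.

Lemma spt_node P P' Q x t u : spt P t -> spt P' u ->
  (forall p p', P p -> P' p' -> spt Q (Node x p p')) -> spt Q (Node x t u).
Proof.
move=> sP sP' PQ; apply: (spt_nodel sP) => p Pp.
by apply: (spt_noder sP') => p' Pp'; apply: PQ.
Qed.

(** Solves a relation for its leading tree, whose coefficient is 1; every FMan relation becomes a
    rewriting rule in this way. *)
Lemma spt_rel Q r s t rest : r \in fman_rels k -> csubst s r = (1, t) :: rest ->
  AllP (fun p => spt Q p.2) rest -> spt Q t.
Proof.
move=> rR rE Qr.
have J : sp Q (coef (csubst s r)).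
  by apply: spn_gen; left; exists (csubst s r) => //; apply: pgen_rel.
have {Qr} Qr : sp Q (coef rest).
  elim: rest Qr {rE} => [|p rest IH] /=; first by move=> _; apply: spn0 => u; rewrite coefc_nil.
  by case=> Qp /IH Qr; apply: (spn_lin Qp Qr) => u; rewrite coefc_cons.
by apply: (spn_sub J Qr) => u; rewrite rE coefc_cons mul1r addrK.
Qed.

Lemma spt_comm Q x t u : spt Q (Node x u t) -> spt Q (Node x t u).
Proof.
move=> Qu; pose s i := nth t [:: t; u] i.
case: x Qu => Qu.
  by apply: (@spt_rel Q (nth [::] (fman_rels k) 1) s _ [:: (1, Node true u t)]);
    rewrite // !inE eqxx ?orbT.
by apply: (@spt_rel Q (nth [::] (fman_rels k) 0) s _ [:: (-1, Node false u t)]);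
  rewrite // !inE eqxx ?orbT.
Qed.

Lemma spt_assoc Q a b c : spt Q (o a (o b c)) -> spt Q (o (o a b) c).
Proof.
move=> Qu; pose s i := nth a [:: a; b; c] i.
by apply: (@spt_rel Q (nth [::] (fman_rels k) 2) s _ [:: (-1, o a (o b c))]);
  rewrite // !inE eqxx ?orbT.
Qed.

Lemma spt_jacobi Q a b c :
  spt Q (br (br b c) a) -> spt Q (br (br c a) b) -> spt Q (br (br a b) c).
Proof.
move=> Q1 Q2; pose s i := nth a [:: a; b; c] i.
by apply: (@spt_rel Q (nth [::] (fman_rels k) 3) s _
   [:: (1, br (br b c) a); (1, br (br c a) b)]); rewrite // !inE eqxx ?orbT.
Qed.

Lemma spt_hertling_manin Q a b c d :
  AllP (spt Q) [:: o (br (o a b) c) d; o (br (o a b) d) c;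
     o a (br b (o c d)); o b (br a (o c d)); o (o a c) (br b d); o (o b c) (br a d);
     o (o b d) (br a c); o (o a d) (br b c)] ->
  spt Q (br (o a b) (o c d)).
Proof.
move=> Qs; pose s i := nth a [:: a; b; c; d] i.
by apply: (@spt_rel Q (nth [::] (fman_rels k) 4) s _ (behead (csubst s (nth [::] (fman_rels k) 4))));
  rewrite // !inE eqxx ?orbT.
Qed.

(** Congruence to some scalar multiple of [u]. Leaving the scalar open spares tracking the signs of
    the bracket and is enough for spanning. *)
Definition reduces t u := spt (eq u) t.

Lemma red_spt Q t u : reduces t u -> spt Q u -> spt Q t.
Proof. by move=> tu Qu; apply: spt_trans tu => v <-. Qed.

Lemma red_refl t : reduces t t. Proof. exact: spt_in. Qed.

Lemma red_trans t u v : reduces t u -> reduces u v -> reduces t v.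
Proof. exact: red_spt. Qed.

Lemma red_comm x t u : reduces (Node x t u) (Node x u t).
Proof. exact/spt_comm/red_refl. Qed.

Lemma red_assoc a b c : reduces (o (o a b) c) (o a (o b c)).
Proof. exact/spt_assoc/red_refl. Qed.

Lemma red_node x t t' u u' : reduces t t' -> reduces u u' -> reduces (Node x t u) (Node x t' u').
Proof. by move=> rt ru; apply: (spt_node rt ru) => p p' <- <-; apply: spt_in. Qed.

Lemma red_swap a b c : reduces (o (o a b) c) (o (o a c) b).
Proof.
have h : reduces (o b (o a c)) (o (o a c) b) by apply: red_comm.
apply: red_trans (red_node _ (red_comm _ a b) (red_refl c)) _.
exact: red_trans (red_assoc _ _ _) h.
Qed.

Lemma red_pr t u ts : reduces t u -> reduces (pr t ts) (pr u ts).
Proof. by elim: ts => //= v ts IH tu; apply: red_node (IH tu) (red_refl v). Qed.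

Lemma red_pr_swap t pre u v ts : reduces (pr t (pre ++ u :: v :: ts)) (pr t (pre ++ v :: u :: ts)).
Proof. by rewrite /pr !foldr_cat; apply: red_pr; apply: red_swap. Qed.

Lemma red_pr_perm t s s' : perm_eq s s' -> reduces (pr t s) (pr t s').
Proof.
move=> ss; apply: (@perm_swap_ind _ (fun s' => reduces (pr t s) (pr t s')) _ _ _ ss).
  by move=> pre u v rest h; apply: red_trans h _; apply: red_pr_swap.
exact: red_refl.
Qed.

Lemma red_pr_head t u s : reduces (pr t (u :: s)) (pr u (t :: s)).
Proof.
apply: red_trans (red_pr_perm _ (s' := rcons s u) _) _.
  by rewrite perm_sym perm_rcons.
rewrite -!cats1 /pr foldr_cat /=.
apply: (red_trans (red_pr s (red_comm _ t u))).
have := red_pr_perm u (s := rcons s t) (s' := t :: s).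
by rewrite -cats1 /pr foldr_cat /=; apply; rewrite cats1 perm_rcons.
Qed.

Lemma red_pr_cat t s u s' : reduces (o (pr t s) (pr u s')) (pr t (s ++ u :: s')).
Proof.
elim: s => [|v s IH] /=; last first.
  by apply: red_trans (red_swap _ _ _) _; apply: red_node IH (red_refl v).
exact: red_trans (red_comm _ _ _) (red_pr_head u t s').
Qed.

Definition oprods (l : seq (tree bool)) := if l is t :: s then pr t s else Leaf 0.

Lemma red_prn_perm l l' : perm_eq l l' -> reduces (oprods l) (oprods l').
Proof.
move=> ll; apply: (@perm_swap_ind _ (fun l' => reduces (oprods l) (oprods l')) _ _ _ ll); last exact: red_refl.
move=> [|t pre] u v rest h; apply: (red_trans h); first exact: red_pr_head.
exact: red_pr_swap.
Qed.

End SpanFMan.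

Definition leR (r r' : rose) := (root r <= root r')%N.

Lemma leR_total : total leR. Proof. by move=> r r'; apply: leq_total. Qed.
Lemma leR_trans : transitive leR. Proof. by move=> r r' r''; apply: leq_trans. Qed.

Lemma sorted_roots rs : sorted ltn [seq root r | r <- rs] = uniq [seq root r | r <- rs] && sorted leR rs.
Proof. by rewrite ltn_sorted_uniq_leq sorted_map. Qed.

Lemma canon_Rose x rs : canon (Rose x rs) = [&& uniq [seq root r | r <- rs], sorted leR rs & all canon rs].
Proof. by rewrite /= sorted_roots andbA. Qed.

Lemma canon_sort x rs : uniq [seq root r | r <- rs] -> all canon rs -> canon (Rose x (sort leR rs)).
Proof.
move=> u c; rewrite canon_Rose (sort_sorted leR_total) all_sort c !andbT.
by rewrite (perm_uniq (perm_map root (permEl (perm_sort leR rs)))).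
Qed.

Lemma root_labels r : root r \in labels r.
Proof. by case: r => x rs; rewrite mem_head. Qed.

Lemma uniq_roots rs : uniq (flatten [seq labels r | r <- rs]) -> uniq [seq root r | r <- rs].
Proof.
elim: rs => //= r rs IH; rewrite cat_uniq => /and3P[_ /hasPn h /IH ->]; rewrite andbT.
apply/mapP => -[r' r'rs e]; have /h : root r' \in flatten [seq labels r | r <- rs].
  by apply/flatten_mapP; exists r' => //; apply: root_labels.
by rewrite -e /= root_labels.
Qed.

Lemma roots_labels rs : {subset [seq root r | r <- rs] <= flatten [seq labels r | r <- rs]}.
Proof.
by move=> _ /mapP[r rrs ->]; apply/flatten_mapP; exists r => //; apply: root_labels.
Qed.

(** The factors of the product encoded by [r]: the word at the root, and the children that hang
    there only as further factors. *)
Definition nfac r := let: Rose x rs := r in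
  Rose x [seq r <- rs | good x r] :: [seq r <- rs | ~~ good x r].

Lemma all_filterC (T : Type) (P : pred T) s : all P s -> [seq x <- s | ~~ P x] = [::].
Proof. by elim: s => //= x s IH /andP[-> /IH]. Qed.

Lemma om_nfac r : om r = oprods [seq om r' | r' <- nfac r].
Proof.
case: r => x rs; rewrite omE [nfac _]/= map_cons omE.
have g : all (good x) [seq r <- rs | good x r] by apply: filter_all.
by rewrite (all_filterP g) (all_filterC g).
Qed.

Lemma om_isN x rs : isN (Rose x rs) -> om (Rose x rs) = adj_word (Leaf x) [seq om r | r <- rs].
Proof.
by rewrite isN_Rose => g; rewrite omE (all_filterP g) (all_filterC g).
Qed.

Lemma nfac_isN r : all isN (nfac r).
Proof.
case: r => x rs; rewrite [nfac _]/= [all _ _]/= -/(isN (Rose x _)) isN_Rose filter_all.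
by apply/allP => r; rewrite mem_filter negb_imply => /andP[/andP[]].
Qed.

Lemma nfac_canon r : canon r -> all canon (nfac r).
Proof.
case: r => x rs; rewrite canon_Rose => /and3P[u s c]; apply/andP; split.
  rewrite canon_Rose sorted_filter //; last exact: leR_trans.
  rewrite (subseq_uniq _ u) ?map_subseq ?filter_subseq //=.
  by apply/allP => r; rewrite mem_filter => /andP[_ /(allP c)].
by apply/allP => r; rewrite mem_filter => /andP[_ /(allP c)].
Qed.

Lemma perm_labels_nfac r : perm_eq (flatten [seq labels r' | r' <- nfac r]) (labels r).
Proof.
case: r => x rs; rewrite [nfac _]/= map_cons /= perm_cons.
rewrite -flatten_cat -map_cat; apply/perm_flatten/perm_map.
exact/permEl/perm_filterC.
Qed.

Lemma size_nfac r : (1 < size (nfac r))%N = ~~ isN r.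
Proof.
case: r => x rs; rewrite isN_Rose -has_predC has_filter.
by rewrite /= ltnS lt0n size_eq0.
Qed.

(** The factor with the largest root x receives the others as children. Its own children are good
    because it is a non-product; the new ones are non-products with root below x, hence not good. So
    the splitting in [nfac] recovers the list. *)
Lemma nfac_surj l : l != [::] -> all isN l -> all canon l ->
  uniq (flatten [seq labels r | r <- l]) ->
  exists2 r, canon r & perm_eq (nfac r) l.
Proof.
move=> l0 Nl cl ul.
pose l' := sort (fun r r' => leR r' r) l.
have pl : perm_eq l' l by apply: permEl; apply: perm_sort.
have sl : sorted (fun r r' => leR r' r) l'.
  by apply: sort_sorted => r r'; apply: leq_total.
case E : l' pl sl => [|[x rs] os] pl sl.
  by move/perm_size: pl => /= /esym/size0nil e; rewrite e in l0.
have := ul; rewrite -(perm_uniq (perm_flatten (perm_map labels pl))) /= => /andP[xos].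
rewrite -flatten_cat -map_cat => /uniq_roots uro.
have := cl; rewrite -(perm_all _ pl) => /andP[cx cos].
have := Nl; rewrite -(perm_all _ pl) => /andP[Nx Nos].
have xlt : {in os, forall r, root r < x}%N.
  move=> r ros; rewrite ltn_neqAle.
  have -> : (root r <= x)%N.
    by have /allP := order_path_min (fun _ _ _ h1 h2 => leq_trans h2 h1) sl; apply.
  rewrite andbT; apply: contra xos => /eqP <-; rewrite mem_cat.
  by rewrite (roots_labels (map_f root ros)) orbT.
have gos : {in os, forall r, good x r = false}.
  by move=> r ros; rewrite /good (allP Nos) //= ltnNge ltnW // xlt.
move: (cx); rewrite canon_Rose => /and3P[u s c].
have grs : all (good x) rs by rewrite -isN_Rose.
exists (Rose x (sort leR (rs ++ os))); first by apply: canon_sort; rewrite ?all_cat ?c.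
apply: perm_trans pl; rewrite /= !(filter_sort leR_total leR_trans) !filter_cat.
rewrite (all_filterP grs) (eq_in_filter (a2 := pred0)) // filter_pred0 cats0.
rewrite (sorted_sort leR_trans s) perm_cons (eq_in_filter (a2 := pred0)); last first.
  by move=> r rrs; rewrite (allP grs).
rewrite filter_pred0 (eq_in_filter (a2 := predT)) ?filter_predT /=; last first.
  by move=> r ros; rewrite gos.
exact/permEl/perm_sort.
Qed.

(** * Spanning FMan(n) by normal forms *)

Section Spanning.
Variable k : fieldType.
Local Notation spt := (spt k).
Local Notation reduces := (reduces k).

Definition NF (A : pred rose) (S : seq nat) (t : tree bool) : Prop :=
  exists r, [/\ canon r, perm_eq (labels r) S, A r & t = om r].

Lemma spt_NF_sub (A B : pred rose) S S' t : {subset A <= B} -> perm_eq S S' ->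
  spt (NF A S) t -> spt (NF B S') t.
Proof.
move=> AB SS; apply: spt_sub => _ [r [cr lr Ar ->]].
by exists r; split=> //; [apply: perm_trans lr SS|apply: AB].
Qed.

Lemma red_prn_cat l l' : l != [::] -> l' != [::] -> reduces (o (oprods l) (oprods l')) (oprods (l ++ l')).
Proof. by case: l l' => [|t s] [|u s'] // _ _; apply: red_pr_cat. Qed.

Lemma nfac_neq0 r : nfac r != [::]. Proof. by case: r. Qed.

(** Concatenate the two factor lists and encode the result as one tree. Two nonempty lists give at
    least two factors, so this tree is a product. *)
Lemma spt_product A A' S S' t u : uniq (S ++ S') -> NF A S t -> NF A' S' u ->
  spt (NF (predC isN) (S ++ S')) (o t u).
Proof.
move=> uS [r [cr lr _ ->]] [r' [cr' lr' _ ->]].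
rewrite (om_nfac r) (om_nfac r').
have le : perm_eq (flatten [seq labels r0 | r0 <- nfac r ++ nfac r']) (S ++ S').
  rewrite map_cat flatten_cat; apply: perm_cat.
    exact: perm_trans (perm_labels_nfac r) lr.
  exact: perm_trans (perm_labels_nfac r') lr'.
have [||||q cq pq] := @nfac_surj (nfac r ++ nfac r').
- by case: (r).
- by rewrite all_cat !nfac_isN.
- by rewrite all_cat !nfac_canon.
- by rewrite (perm_uniq le).
apply: (red_spt (red_prn_cat _ _)); rewrite -?size_eq0 ?size_map ?size_eq0 ?nfac_neq0 //.
rewrite -map_cat; apply: (red_spt (u := om q)).
  by rewrite om_nfac; apply/red_prn_perm/perm_map; rewrite perm_sym.
apply: spt_in; exists q; split=> //.
  rewrite perm_sym; apply: perm_trans (perm_labels_nfac q); rewrite perm_sym.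
  exact: perm_trans (perm_flatten (perm_map _ pq)) le.
rewrite /= -size_nfac (perm_size pq) size_cat.
by case: (r) (r') => [? ?] [? ?] /=; rewrite addnS.
Qed.

Definition spanned_upto n := forall t, uniq (leaves t) -> (size (leaves t) <= n)%N ->
  spt (NF predT (leaves t)) t.

(** Vacuous on products, and [atleast x.+1] is [good x]. The threshold ensures that a bracket of two
    admissible entries of a word expands into admissible entries again. *)
Definition atleast m r := isN r ==> (m <= root r)%N.

Definition brackets_spanned_upto n := forall m r r', canon r -> canon r' -> uniq (labels r ++ labels r') ->
  (size (labels r ++ labels r') <= n)%N -> atleast m r -> atleast m r' ->
  spt (NF (atleast m) (labels r ++ labels r')) (br (om r) (om r')).

Definition adjoints_spanned_upto n := forall x rs, all canon rs -> all (good x) rs ->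
  uniq (labels (Rose x rs)) -> (size (labels (Rose x rs)) <= n)%N ->
  spt (NF [pred r | isN r && (root r == x)] (labels (Rose x rs)))
      (adj_word (Leaf x) [seq om r | r <- rs]).

Lemma spt_ad P Q t ts : spt P t -> (forall p, P p -> spt Q (adj_word p ts)) -> spt Q (adj_word t ts).
Proof.
move=> sP PQ.
have : spt (fun u => exists2 p, P p & u = adj_word p ts) (adj_word t ts).
  elim: ts {PQ} => [|u ts IH] /=; first by apply: spt_sub sP => p Pp; exists p.
  by apply: (spt_nodel IH) => _ [p Pp ->]; apply: spt_in; exists p.
by apply: spt_trans => _ [p Pp ->]; apply: PQ.
Qed.

Lemma ad_cat t s s' : adj_word t (s ++ s') = adj_word (adj_word t s') s.
Proof. exact: foldr_cat. Qed.

(** Jacobi as a commutation rule: exchanging the entries b and c costs a term in which they are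
    merged into [b,c]. *)
Lemma spt_bracket_swap a b c :
  spt (fun t => t = br (br a c) b \/ t = br a (br b c)) (br (br a b) c).
Proof.
apply: spt_jacobi.
  by apply: spt_comm; apply: spt_in; right.
by apply: (spt_nodel (red_comm k true c a)) => _ <-; apply: spt_in; left.
Qed.

Lemma labels_uniq_sub r rs : r \in rs -> uniq (flatten [seq labels r | r <- rs]) -> uniq (labels r).
Proof.
elim: rs => //= r' rs IH; rewrite inE cat_uniq => /predU1P[->|/IH h] /and3P[u1 _ u2] //.
exact: h.
Qed.

(* Permuting the entries of the word creates words with one entry fewer, because brackets of
   good elements are combinations of good elements. *)
Lemma brackets_adjoints n : brackets_spanned_upto n -> adjoints_spanned_upto n.+1.
Proof.
move=> brn x rs; elim: {rs}(size rs) {-2}rs (leqnn (size rs)) => [|p IHp] rs.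
  case: rs => // _ _ _ _ _; apply: spt_in; exists (Rose x [::]); split=> //.
  by rewrite /= eqxx.
move=> sz cr gr ur szr.
(* The sorted word is already a normal form; any other order is reached from it by adjacent
   swaps. *)
pose rs' := sort leR rs.
have prs : perm_eq rs' rs by apply/permEl/perm_sort.
set Q := NF _ _.
suff : perm_eq rs rs -> spt Q (adj_word (Leaf x) [seq om r | r <- rs]) by apply.
apply: (@perm_swap_ind _ (fun l => perm_eq l rs -> spt Q (adj_word (Leaf x) [seq om r | r <- l]))
          rs' rs) => //; last first.
  move=> _; apply: spt_in; exists (Rose x rs'); split.
  - by apply: canon_sort => //; move: ur => /= /andP[_ /uniq_roots].
  - by rewrite /= perm_cons; apply/perm_flatten/perm_map.
  - by rewrite inE isN_Rose all_sort gr eqxx.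
  - by rewrite om_isN // isN_Rose all_sort.
move=> pre b a rest IH pe; rewrite map_cat ad_cat.
apply: (spt_ad (spt_bracket_swap _ _ _)) => _ [->|->].
  have := IH (perm_trans _ pe); rewrite map_cat ad_cat; apply.
  by rewrite perm_cat2l -[b :: _]cat1s -[a :: _]cat1s perm_catCA.
have pe' : perm_eq (a :: b :: pre ++ rest) rs.
  apply: perm_trans pe; apply/seq.permP => q; rewrite /= !count_cat /=; countlia.
have [ca cb cpr] : [/\ canon a, canon b & all canon (pre ++ rest)].
  by move: cr; rewrite -(perm_all _ pe') => /and3P[].
have [ga gb gpr] : [/\ good x a, good x b & all (good x) (pre ++ rest)].
  by move: gr; rewrite -(perm_all _ pe') => /and3P[].
have pl : perm_eq (labels a ++ labels b ++ flatten [seq labels r | r <- pre ++ rest])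
                  (flatten [seq labels r | r <- rs]).
  exact: (perm_flatten (perm_map labels pe')).
have := ur; rewrite /= -(perm_mem pl) -(perm_uniq pl) => /andP[xn ul].
have := szr; rewrite /= ltnS -(perm_size pl) => szl.
have sp1 : spt (NF (good x) (labels b ++ labels a)) (br (om b) (om a)).
  (* The head x uses up one label, so the two entries together have at most n. *)
  apply: (brn x.+1) => //.
    by move: ul; rewrite catA cat_uniq uniq_catC => /andP[].
  by apply: leq_trans szl; rewrite !size_cat addnA [X in (_ <= X + _)%N]addnC leq_addr.
have sp2 : spt (fun t => exists2 c, NF (good x) (labels b ++ labels a) c
    & t = br (adj_word (Leaf x) [seq om r | r <- rest]) c)
    (br (adj_word (Leaf x) [seq om r | r <- rest]) (br (om b) (om a))).
  by apply: (spt_noder sp1) => c Pc; apply: spt_in; exists c.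
apply: (spt_ad sp2) => _ [_ [c [cc lincombf gc ->] ->]].
have pc : perm_eq (x :: flatten [seq labels r | r <- pre ++ c :: rest]) (labels (Rose x rs)).
  rewrite /= perm_cons; apply: perm_trans pl.
  move/seq.permP: lincombf => lincombf; apply/seq.permP => q; rewrite !map_cat !flatten_cat /= !count_cat lincombf !count_cat.
  by rewrite addnCA -addnA addnCA.
have := IHp (pre ++ c :: rest); rewrite map_cat ad_cat /= => IH'.
apply: (spt_NF_sub _ pc (IH' _ _ _ _ _)) => //.
- by move/perm_size: pe sz => <-; rewrite !size_cat /=; countlia.
- by move: cpr; rewrite !all_cat /= cc.
- by move: gpr; rewrite !all_cat /= gc.
- by move: ur; rewrite -(perm_uniq pc).
- by move: szr; rewrite -(perm_size pc).
Qed.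

Lemma leq_addl_lt a b n : (a + b <= n.+1 -> 0 < b -> a <= n)%N.
Proof. lia. Qed.

Lemma leq_addr_lt a b n : (a + b <= n.+1 -> 0 < a -> b <= n)%N.
Proof. lia. Qed.

Lemma spanned_product n t u : spanned_upto n -> uniq (leaves t ++ leaves u) ->
  (size (leaves t) <= n)%N -> (size (leaves u) <= n)%N ->
  spt (NF (predC isN) (leaves t ++ leaves u)) (o t u).
Proof.
move=> mn utu st su; have := utu; rewrite cat_uniq => /and3P[ut _ uu].
apply: (spt_node (mn t ut st) (mn u uu su)) => p p'.
exact: spt_product.
Qed.

Lemma om_product r : ~~ isN r -> exists t u, om r = o t u.
Proof.
rewrite -size_nfac om_nfac; case: (nfac r) => [|a [|b l]] //= _.
by exists (pr (om a) [seq om r' | r' <- l]), (om b).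
Qed.

Lemma size_leaves_gt0 (t : tree bool) : (0 < size (leaves t))%N.
Proof. by elim: t => //= a l IHl r IHr; rewrite size_cat; lia. Qed.

(* A bracket of two products is rewritten by the Hertling--Manin relation; in all other cases one
   of the two arguments can be appended as an entry to the word of the other. *)
Lemma adjoints_brackets n : spanned_upto n -> adjoints_spanned_upto n.+1 -> brackets_spanned_upto n.+1.
Proof.
move=> mn an m r r' cr cr' u sz ar ar'.
have NN (q q' : rose) : canon q -> canon q' -> uniq (labels q ++ labels q') ->
    (size (labels q ++ labels q') <= n.+1)%N -> atleast m q -> isN q -> good (root q) q' ->
    spt (NF (atleast m) (labels q ++ labels q')) (br (om q) (om q')).
  case: q => x rs cq cq' uq sq aq Nq gq.
  have pe : perm_eq (labels (Rose x (q' :: rs))) (labels (Rose x rs) ++ labels q').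
    by rewrite /= perm_cons perm_catC.
  have := an x (q' :: rs); rewrite om_isN // => h.
  apply: (spt_NF_sub _ pe (h _ _ _ _)).
  - move=> q /andP[_ /eqP e]; rewrite unfold_in /atleast e.
    by move: aq; rewrite /atleast Nq /= => ->; rewrite implybT.
  - by move: cq; rewrite canon_Rose => /and3P[_ _ /= ->]; rewrite cq'.
  - by rewrite /= gq.
  - by rewrite (perm_uniq pe).
  - by rewrite (perm_size pe).
have NN' (q q' : rose) : canon q -> canon q' -> uniq (labels q' ++ labels q) ->
    (size (labels q' ++ labels q) <= n.+1)%N -> atleast m q -> isN q -> good (root q) q' ->
    spt (NF (atleast m) (labels q' ++ labels q)) (br (om q') (om q)).
  move=> cq cq' uq sq aq Nq gq; apply: spt_comm.
  apply: spt_NF_sub (NN q q' cq cq' _ _ aq Nq gq) => //.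
  - by rewrite perm_catC.
  - by rewrite uniq_catC.
  - by rewrite size_cat addnC -size_cat.
have [Nr|nNr] := boolP (isN r).
  have [Nr'|nNr'] := boolP (isN r'); last by apply: NN => //; rewrite /good (negPf nNr').
  have ne : root r != root r'.
    apply/eqP => e; move: u; rewrite cat_uniq => /and3P[_ /hasPn/(_ _ (root_labels r')) /= h _].
    by rewrite -e root_labels in h.
  case: (ltngtP (root r) (root r')) ne => // lt _.
    by apply: NN => //; rewrite /good lt implybT.
  by apply: NN' => //; rewrite /good lt implybT.
have [Nr'|nNr'] := boolP (isN r'); first by apply: NN' => //; rewrite /good (negPf nNr).
have [a [b e]] := om_product nNr; have [c [d e']] := om_product nNr'.
have pl : perm_eq (labels r ++ labels r') ((leaves a ++ leaves b) ++ (leaves c ++ leaves d)).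
  by rewrite perm_sym; apply: perm_cat; have := perm_leaves_om; [move/(_ r); rewrite e|move/(_ r'); rewrite e'].
have := size_leaves_gt0 a; have := size_leaves_gt0 b.
have := size_leaves_gt0 c; have := size_leaves_gt0 d => d0 c0 b0 a0.
have := sz; rewrite (perm_size pl) !size_cat => {}sz.
(* All eight remaining terms of the Hertling--Manin relation are products of two smaller trees, and
   products satisfy any threshold, so [spanned_upto n] on the two factors suffices. *)
have key v w : perm_eq (leaves v ++ leaves w) ((leaves a ++ leaves b) ++ (leaves c ++ leaves d)) ->
    spt (NF (atleast m) (labels r ++ labels r')) (o v w).
  move=> pe; have sv := size_leaves_gt0 v; have sw := size_leaves_gt0 w.
  have := perm_size pe; rewrite !size_cat => szvw.
  apply: (@spt_NF_sub (predC isN) _ (leaves v ++ leaves w)).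
  - by move=> q /negPf Nq; rewrite unfold_in /atleast Nq.
  - by rewrite perm_sym in pl; apply: perm_trans pe pl.
  - have uvw : uniq (leaves v ++ leaves w) by rewrite (perm_uniq pe) -(perm_uniq pl).
    rewrite -szvw in sz.
    by apply: (spanned_product mn uvw); [apply: leq_addl_lt sz sw|apply: leq_addr_lt sz sv].
rewrite e e'; apply: spt_hertling_manin.
by split; [|split; [|split; [|split; [|split; [|split; [|split; [|split]]]]]]] => //;
  apply: key; apply/seq.permP => q; rewrite /= !count_cat; countlia.
Qed.

(** Brackets with at most n labels handle words with n+1; these, with products of smaller trees,
    handle brackets with n+1; and a tree with n+1 leaves is a leaf, a product or a bracket of
    smaller trees. *)
Lemma spanning_induction n : spanned_upto n /\ brackets_spanned_upto n.
Proof.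
elim: n => [|n [mn brn]].
  split=> [t _|m r r' _ _ _]; first by rewrite leqNgt size_leaves_gt0.
  by rewrite leqn0 size_cat; case: (r).
have an := brackets_adjoints brn; have br1 := adjoints_brackets mn an.
split=> // -[i|b t u] /=.
  by move=> _ _; apply: spt_in; exists (Rose i [::]).
move=> utu; rewrite size_cat => sz.
have := size_leaves_gt0 t; have := size_leaves_gt0 u => u0 t0.
case: b; last first.
  apply: spt_NF_sub (spanned_product mn utu _ _) => //.
    exact: leq_addl_lt sz u0.
  exact: leq_addr_lt sz t0.
have := utu; rewrite cat_uniq => /and3P[ut _ uu].
apply: (spt_node (mn t ut _) (mn u uu _)) => [||p p' [r [cr lr _ ->]] [r' [cr' lr' _ ->]]].
- exact: leq_addl_lt sz u0.
- exact: leq_addr_lt sz t0.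
have pl := perm_cat lr lr'.
apply: (@spt_NF_sub (atleast 0) _ _ _ _ _ pl) => //.
apply: br1 => //; rewrite ?(perm_uniq pl) ?(perm_size pl) ?size_cat // /atleast ?leq0n ?implybT //.
Qed.

Lemma spt_normal_form t : uniq (leaves t) -> spt (NF predT (leaves t)) t.
Proof. by move=> ut; apply: (spanning_induction _).1. Qed.

End Spanning.

(** * Rooted trees as parent functions *)

Section Edges.

Fixpoint edges (r : rose) : seq (nat * nat) :=
  let: Rose x rs := r in flatten [seq (root r', x) :: edges r' | r' <- rs].

Lemma labels_edges r : labels r = root r :: [seq e.1 | e <- edges r].
Proof.
elim/rose_ind': r => x rs IH /=; congr cons; rewrite map_flatten -map_comp; congr flatten.
by apply/eq_in_map => r rrs /=; rewrite IH.
Qed.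

Lemma edges_labels r e : e \in edges r -> e.2 \in labels r.
Proof.
elim/rose_ind': r => x rs IH /flatten_mapP[r rrs]; rewrite !inE => /predU1P[->|er] /=.
  by rewrite eqxx.
by apply/orP; right; apply/flatten_mapP; exists r => //; apply: IH.
Qed.

Definition epar r j : option nat := ohead [seq e.2 | e <- edges r & e.1 == j].

Lemma eparP r j v : uniq (labels r) -> epar r j = Some v <-> (j, v) \in edges r.
Proof.
rewrite labels_edges /= /epar => /andP[_]; elim: (edges r) => //= -[a b] s IH /andP[ns us].
rewrite inE xpair_eqE; case: (eqVneq a j) => [e|ne] /=.
  subst j; split=> [[->]|]; first by rewrite eqxx.
  case/predU1P=> [-> //|h].
  by move: ns; rewrite (map_f (fun e => e.1) h).
exact: IH.
Qed.

Lemma epar_notin r j : j \notin [seq e.1 | e <- edges r] -> epar r j = None.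
Proof.
rewrite /epar; elim: (edges r) => //= -[a b] s IH.
by rewrite inE negb_or eq_sym => /andP[/negPf-> /IH].
Qed.

Lemma iter_None par d : iter d (obind par) None = None :> option nat.
Proof. by elim: d => //= d ->. Qed.

Lemma edges_depth par r : (forall e, e \in edges r -> par e.1 = Some e.2) ->
  forall j, j \in labels r -> exists2 d, (d < size (labels r))%N &
    iter d (obind par) (Some j) = Some (root r).
Proof.
elim/rose_ind': r => x rs IH pe j; rewrite inE => /predU1P[->|]; first by exists 0%N.
case/flatten_mapP => r rrs jr; have [e er|d ds dE] := IH r rrs _ j jr.
  by apply: pe; apply/flatten_mapP; exists r; rewrite // inE er orbT.
exists d.+1; last first.
  rewrite /= dE /= (pe (root r, x)) //=.
  by apply/flatten_mapP; exists r; rewrite // mem_head.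
rewrite /= ltnS; apply: leq_trans ds _.
rewrite size_flatten /shape -map_comp sumnE big_map.
by rewrite (big_rem r) //= leq_addr.
Qed.

Lemma uniq_labels_inj r r' rs v : uniq (flatten [seq labels r | r <- rs]) ->
  r \in rs -> r' \in rs -> v \in labels r -> v \in labels r' -> r' = r.
Proof.
move=> + + + vr vr'; elim: rs => //= q qs IH; rewrite !inE cat_uniq => /and3P[_ /hasPn hn uq].
have inq p : p \in qs -> v \in labels p -> v \notin labels q.
  by move=> pqs vp; apply: hn; apply/flatten_mapP; exists p.
case/predU1P=> [rq|rqs] /predU1P[r'q|r'qs]; first by rewrite rq.
- by have := inq _ r'qs vr'; rewrite -rq vr.
- by have := inq _ rqs vr; rewrite -r'q vr'.
- exact: IH.
Qed.

(** [m] is fuel bounding the height. Running through [iota 0 n] lists siblings in increasing order,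
    as [canon] demands. *)
Fixpoint build n (par : nat -> option nat) m i : rose :=
  Rose i (if m is m'.+1 then [seq build n par m' j | j <- iota 0 n & par j == Some i] else [::]).

Lemma root_build n par m i : root (build n par m i) = i.
Proof. by case: m. Qed.

(** The parent relation determines the set of children at each vertex, and [canon] determines their
    order. The fuel lasts because the number of labels drops at each level. *)
Lemma build_edges n par m r : canon r -> uniq (labels r) ->
  {in labels r, forall v j, j < n -> par j = Some v <-> (j, v) \in edges r}%N ->
  {in labels r, forall v, v < n}%N ->
  (size (labels r) <= m.+1)%N -> build n par m (root r) = r.
Proof.
elim: m r => [|m IH] [x rs] cr ur per lr sr.
  move: sr; rewrite /=; case: rs {cr ur per lr} => //= r rs.
  by rewrite size_cat; case: r.
have cE : [seq j <- iota 0 n | par j == Some x] = [seq root r | r <- rs].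
  apply: (irr_sorted_eq ltn_trans ltnn).
  - by apply: sorted_filter; [apply: ltn_trans|apply: iota_ltn_sorted].
  - by move: cr => /= /andP[].
  move=> j; rewrite mem_filter mem_iota add0n /=; apply/andP/mapP.
    case=> /eqP pj jn; have /per/(_ j jn)[/(_ pj)] : x \in labels (Rose x rs) by rewrite mem_head.
    case/flatten_mapP => r rrs; rewrite inE => /predU1P[[->]|]; first by exists r.
    move=> h _; case/andP: ur => /negP[]; apply/flatten_mapP; exists r => //.
    exact: (edges_labels h).
  case=> r rrs ->; have rn : (root r < n)%N.
    apply: lr; rewrite inE; apply/orP; right; apply/flatten_mapP.
    by exists r => //; apply: root_labels.
  split=> //; apply/eqP; apply/(per x _ _ rn); first by rewrite mem_head.
  by apply/flatten_mapP; exists r; rewrite // mem_head.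
rewrite /= cE -map_comp; congr Rose; rewrite -[RHS]map_id; apply/eq_in_map => r rrs /=.
have sub : {subset labels r <= labels (Rose x rs)}.
  by move=> v vr; rewrite inE; apply/orP; right; apply/flatten_mapP; exists r.
have url' : uniq (flatten [seq labels r | r <- rs]) by move: ur => /= /andP[].
have url : uniq (labels r) by apply: labels_uniq_sub rrs url'.
apply: IH => //.
- by move: cr => /= /andP[_ /allP]; apply.
- move=> v vr j jn; apply: (iff_trans (per v (sub v vr) j jn)); split=> [|h]; last first.
    by apply/flatten_mapP; exists r; rewrite // inE h orbT.
  case/flatten_mapP => r' r'rs; rewrite inE => /predU1P[[_ vx]|h].
    case/andP: ur => /negP[]; apply/flatten_mapP; exists r => //.
    by rewrite -vx.
  have [e|ne] := eqVneq r' r; first by rewrite -e.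
  by rewrite (uniq_labels_inj url' rrs r'rs vr (edges_labels h)) eqxx in ne.
- by move=> v /sub /lr.
- move: sr; rewrite /= ltnS; apply: leq_trans.
  rewrite size_flatten /shape -map_comp sumnE big_map.
  by rewrite (big_rem r) //= leq_addr.
Qed.

Lemma edges_build n par m i e : e \in edges (build n par m i) -> par e.1 = Some e.2.
Proof.
elim: m i => //= m IH i /flatten_mapP[_ /mapP[j + ->]]; rewrite mem_filter => /andP[/eqP pj _].
rewrite inE root_build => /predU1P[->|] //; exact: IH.
Qed.

Variant rooted_at n (par : nat -> option nat) (r : nat) : Prop := RootedAt of
  (r < n)%N & par r = None & (forall i, i < n -> par i = None -> i = r)%N &
  (forall i j, par i = Some j -> i < n /\ j < n)%N &
  (forall i, i < n -> iter n (obind par) (Some i) = None)%N.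

(** Each copy of v below i corresponds to a number d of steps leading from v up to i. Counting
    multiplicities settles presence and uniqueness of labels together. *)
Lemma count_labels_build n par m i v : (v < n)%N -> (i < n)%N ->
  (forall i j, par i = Some j -> i < n /\ j < n)%N ->
  count_mem v (labels (build n par m i)) =
  (\sum_(d < m.+1) (iter d (obind par) (Some v) == Some i))%N.
Proof.
move=> vn + parn; elim: m i => [|m IH] i iltn.
  by rewrite big_ord_recl big_ord0 /= !addn0 eq_sym.
rewrite big_ord_recl /= [i == v]eq_sym; congr (_ + _)%N.
rewrite count_flatten -!map_comp sumnE !big_map big_filter.
transitivity (\sum_(j <- iota 0 n | par j == Some i)
    \sum_(d < m.+1) (iter d (obind par) (Some v) == Some j))%N.
  rewrite big_mkcond [RHS]big_mkcond; apply: eq_big_seq => j.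
  by rewrite mem_iota => /andP[_ jn]; rewrite /= (IH j jn).
rewrite exchange_big /=; apply: eq_bigr => d _.
have : if iter d (obind par) (Some v) is Some w then (w < n)%N else true.
  elim: (d : nat) => //= d'; case: (iter _ _ _) => //= w wn.
  by case E: (par w) => [u|] //; case: (parn _ _ E).
case: (iter _ _ _) => [w|] wn /=; last by rewrite big1.
transitivity (\sum_(j <- iota 0 n) ((w == j) && (par w == Some i)))%N.
  rewrite big_mkcond; apply: eq_bigr => j _.
  rewrite (inj_eq (@Some_inj _)); case: (eqVneq w j) => [->|ne] //=; last by case: ifP.
rewrite (bigD1_seq w) ?iota_uniq ?mem_iota //= eqxx big1 ?addn0 // => j.
by rewrite eq_sym => /negPf ->.
Qed.

Lemma labels_build_lt n par m i : (i < n)%N -> {in labels (build n par m i), forall v, v < n}%N.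
Proof.
elim: m i => [|m IH] i iltn v; first by rewrite inE => /eqP ->.
rewrite inE => /predU1P[-> //|].
case/flatten_mapP => _ /mapP[j + ->]; rewrite mem_filter mem_iota add0n => /and3P[_ _ jn].
exact: IH.
Qed.

(** Every orbit dies, and its last living point has no parent, hence is r. It meets r at that time
    only, so every label occurs exactly once. *)
Lemma labels_build n par r : rooted_at n par r -> perm_eq (labels (build n par n r)) (iota 0 n).
Proof.
case=> rn pr0 pr1 parn parI; apply/allP => v _ /=; apply/eqP.
rewrite (count_uniq_mem _ (iota_uniq _ _)) mem_iota add0n /=.
have [vn|nv] := ltnP v n; last first.
  apply/count_memPn/negP => /(labels_build_lt rn).
  by rewrite ltnNge nv.
rewrite count_labels_build //.
have ex : exists d, iter d.+1 (obind par) (Some v) == None.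
  by exists n.-1; rewrite prednK ?parI // (leq_ltn_trans _ vn).
case: (ex_minnP ex) => d0 /eqP d0N dmin.
have mono d d' : (d <= d')%N -> iter d (obind par) (Some v) = None ->
    iter d' (obind par) (Some v) = None.
  by move=> /subnK <-; rewrite iterD => ->; rewrite iter_None.
have d0n : (d0 < n)%N.
  by rewrite -(@prednK n) ?ltnS ?(leq_ltn_trans _ vn) // dmin // prednK ?parI // (leq_ltn_trans _ vn).
have [w wE] : exists w, iter d0 (obind par) (Some v) = Some w.
  case E: (iter d0 _ _) => [w|]; first by exists w.
  case: d0 E dmin {d0N d0n} => // d E /(_ d); rewrite E eqxx ltnn => h.
  by have := h isT.
have wn : (w < n)%N.
  case: (d0) wE => [[<-]|d] //=; case: (iter _ _ _) => //= u.
  by case/parn.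
have wr : w = r by apply: pr1 => //; move: d0N; rewrite /= wE.
rewrite (bigD1 (Ordinal (leqW d0n))) //= wE wr eqxx big1 // => d ne.
apply/eqP; rewrite eqb0; apply/negP => /eqP dE.
have dN : iter d.+1 (obind par) (Some v) = None by rewrite /= dE.
move: ne; rewrite -val_eqE /= neq_ltn => /orP[lt|lt].
  by have := dmin d; rewrite dN eqxx => /(_ isT); rewrite leqNgt lt.
by rewrite (mono _ _ lt d0N) in dE.
Qed.

End Edges.

Section Rtree.
Variable n : nat.

Definition fpar (f : {ffun 'I_n -> option 'I_n}) (i : nat) : option nat :=
  obind (fun j : 'I_n => omap val (f j)) (insub i).

Lemma fparE f (i : 'I_n) : fpar f i = omap val (f i).
Proof. by rewrite /fpar valK. Qed.

Lemma fpar_lt f i j : fpar f i = Some j -> (i < n)%N /\ (j < n)%N.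
Proof.
rewrite /fpar; case: insubP => //= u iltn _.
by case: (f u) => //= w [<-].
Qed.

Lemma iter_fpar f d (oi : option 'I_n) :
  iter d (obind (fpar f)) (omap val oi) = omap val (iter d (fun x => obind f x) oi).
Proof.
elim: d => //= d ->; case: (iter _ _ _) => //= i; exact: fparE.
Qed.

Definition troot (h : rtree n) : nat :=
  if [pick i | val h i == None] is Some i then val i else 0%N.

Lemma rooted_troot (h : rtree n) : rooted_at n (fpar (val h)) (troot h).
Proof.
have /andP[c1 /forallP it] := valP h.
have [r0 r0E] : exists r0, [pred i | val h i == None] =i pred1 r0.
  exact/card1P.
rewrite /troot; case: pickP => [r /eqP hr|no]; last first.
  by have := r0E r0; rewrite !inE eqxx no.
split=> //.
- exact: ltn_ord.
- by rewrite fparE hr.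
- move=> i iltn; rewrite (fparE _ (Ordinal iltn)); case E: (val h _) => // _.
  have h1 := r0E (Ordinal iltn); have h2 := r0E r.
  rewrite !inE E eqxx in h1; rewrite !inE hr eqxx in h2.
  by rewrite (eqP (esym h2)) -(eqP (esym h1)).
- exact: fpar_lt.
- move=> i iltn; have := iter_fpar (val h) n (Some (Ordinal iltn)).
  by rewrite /= => ->; rewrite (eqP (it _)).
Qed.

Definition rose_of (h : rtree n) : rose := build n (fpar (val h)) n (troot h).

Lemma labels_rose_of h : perm_eq (labels (rose_of h)) (iota 0 n).
Proof. exact/labels_build/rooted_troot. Qed.

(** Lets [rtree n] index the normal forms: each tree produced by the spanning argument comes from a
    parent function. *)
Lemma rose_of_surj r : canon r -> perm_eq (labels r) (iota 0 n) -> exists h, rose_of h = r.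
Proof.
move=> cr lr.
have ur : uniq (labels r) by rewrite (perm_uniq lr) iota_uniq.
have ltl v : (v \in labels r) = (v < n)%N by rewrite (perm_mem lr) mem_iota.
pose f : {ffun 'I_n -> option 'I_n} := [ffun i : 'I_n => obind insub (epar r (val i))].
have fE j : fpar f j = epar r j.
  rewrite /fpar; case: insubP => [u _ <-|jn] /=; last first.
    rewrite epar_notin //; apply: contra jn => h.
    by rewrite -ltl labels_edges inE h orbT.
  rewrite ffunE; case E: (epar r (val u)) => [v|] //=.
  have /edges_labels : (val u, v) \in edges r by apply/eparP.
  by rewrite ltl /= => vn; rewrite insubT.
have rn : (root r < n)%N by rewrite -ltl root_labels.
have proot : epar r (root r) = None.
  by apply: epar_notin; move: ur; rewrite labels_edges => /andP[].
have fN i : (f i == None) = (i == Ordinal rn).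
  have : fpar f i = epar r i by [].
  rewrite fparE -val_eqE /= => e; apply/eqP/eqP => [fi|ir].
    rewrite fi /= in e; have : val i \in labels r by rewrite ltl ltn_ord.
    rewrite labels_edges inE => /predU1P[] // /mapP[[a b] ab ie].
    have /eparP : (a, b) \in edges r by [].
    by move/(_ ur); rewrite -[a]ie -e.
  by rewrite ir proot in e; case: (f i) e.
have rf : rooted f.
  apply/andP; split; first by apply/card1P; exists (Ordinal rn) => i; rewrite !inE fN.
  apply/forallP => i; have := iter_fpar f n (Some i); rewrite /=.
  have fe e : e \in edges r -> fpar f e.1 = Some e.2.
    by move=> er; rewrite fE; apply/eparP => //; case: e er.
  have [|d ds dE] := edges_depth fe (j := i); first by rewrite ltl ltn_ord.
  rewrite (perm_size lr) size_iota in ds.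
  have past m : (d < m)%N -> iter m (obind (fpar f)) (Some (val i)) = None.
    by move=> /subnK <-; rewrite iterD /= dE /= fE proot iter_None.
  rewrite (past _ ds).
  by case: (iter _ _ _).
pose h : rtree n := exist _ f rf.
exists h; have [tn t0 t1 _ _] := rooted_troot h.
have -> : rose_of h = build n (fpar f) n (root r).
  rewrite /rose_of; congr build; symmetry; apply: t1 => //.
  by rewrite fE.
apply: build_edges => //.
- by move=> v vr j jn; rewrite fE; apply: eparP.
- by move=> v; rewrite ltl.
- by rewrite (perm_size lr) size_iota leqnSn.
Qed.

End Rtree.

(** * Pairing PreLie with rooted trees *)

Section Chi.
Implicit Types (par : nat -> option nat) (t u : tree unit).

Fixpoint lroot t : nat := match t with Leaf i => i | Node _ l _ => lroot l end.

(* The pre-Lie symmetry is visible here: the associator of a, b, c contributes the product of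
   chi(a) chi(b) chi(c) with the multiplicities of par(root b) and par(root c) in the leaves of a. *)
Fixpoint chi par t : nat :=
  match t with
  | Leaf _ => 1
  | Node _ l r => chi par l * chi par r *
      (if par (lroot r) is Some v then count_mem v (leaves l) else 0)
  end.

(** An enclosing vertex contributes a factor that depends only on [lroot] and the multiset of
    leaves. Both agree on all terms of [g], so the factor leaves the sum; this is why homogeneity is
    proved along with the vanishing. *)
Lemma chi_pgen (k : fieldType) par (g : comb k unit) : pgen (prelie_rels k) g ->
  {in g &, forall p q, lroot p.2 = lroot q.2 /\ perm_eq (leaves p.2) (leaves q.2)} /\
  \sum_(p <- g) p.1 * (chi par p.2)%:R = 0.
Proof.
elim=> [r s|[] u {}g pg [hom IH]|[] u {}g pg [hom IH]].
- rewrite inE => /eqP ->; split.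
    have E q : q \in csubst s [:: (1, Node tt (Node tt (Leaf 0) (Leaf 1)) (Leaf 2));
        (-1, Node tt (Leaf 0) (Node tt (Leaf 1) (Leaf 2)));
        (-1, Node tt (Node tt (Leaf 0) (Leaf 2)) (Leaf 1));
        (1, Node tt (Leaf 0) (Node tt (Leaf 2) (Leaf 1)))] ->
      lroot q.2 = lroot (s 0%N) /\
      perm_eq (leaves q.2) (leaves (s 0%N) ++ leaves (s 1%N) ++ leaves (s 2%N)).
      rewrite /= !inE => /or4P[] /eqP-> /=; split=> //; rewrite -?catA //.
        by rewrite perm_cat2l perm_catC.
      by rewrite perm_cat2l perm_catC.
    move=> p q /E[-> h1] /E[-> h2]; split=> //; apply: perm_trans h1 _.
    by rewrite perm_sym.
  rewrite /csubst /= !big_cons big_nil /=.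
  case: (par (lroot (s 1%N))) => [v|]; case: (par (lroot (s 2%N))) => [w|];
    rewrite ?count_cat !natrM ?natrD; ring.
- split=> [p q /mapP[p' pg' ->] /mapP[q' qg' ->] /=|].
    by have [-> h] := hom _ _ pg' qg'; split=> //; rewrite perm_cat2r.
  rewrite big_map; case: (g) hom IH => [|p0 g0] hom IH; first by rewrite big_nil.
  set c := (chi par u * (if par (lroot u) is Some v then count_mem v (leaves p0.2) else 0))%N.
  transitivity ((\sum_(p <- p0 :: g0) p.1 * (chi par p.2)%:R) * c%:R : k); last by rewrite IH mul0r.
  rewrite mulr_suml; apply: eq_big_seq => p pg' /=.
  rewrite -mulrA -natrM; congr (_ * _%:R); rewrite /c -mulnA; congr (_ * (_ * _))%N.
  case: (par (lroot u)) => // v; have [|_ /seq.permP ->] := hom p p0 pg'; rewrite ?mem_head //.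
- split=> [p q /mapP[p' pg' ->] /mapP[q' qg' ->] /=|].
    by have [_ h] := hom _ _ pg' qg'; split=> //; rewrite perm_cat2l.
  rewrite big_map; case: (g) hom IH => [|p0 g0] hom IH; first by rewrite big_nil.
  set c := (chi par u * (if par (lroot p0.2) is Some v then count_mem v (leaves u) else 0))%N.
  transitivity ((\sum_(p <- p0 :: g0) p.1 * (chi par p.2)%:R) * c%:R : k); last by rewrite IH mul0r.
  rewrite mulr_suml; apply: eq_big_seq => p pg' /=.
  rewrite -mulrA -natrM; congr (_ * _%:R); rewrite /c.
  by have [|<- _] := hom p p0 pg'; rewrite ?mem_head // mulnAC mulnC.
Qed.

(** [chi] tests the edges; the first factor tests that the monomial and the tree have the same
    root. *)
Definition pi (k : fieldType) par t : k := (par (lroot t) == None)%:R * (chi par t)%:R.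

Lemma pi_pgen (k : fieldType) par (g : comb k unit) : pgen (prelie_rels k) g ->
  \sum_(p <- g) p.1 * pi k par p.2 = 0.
Proof.
move=> /(chi_pgen par)[hom]; case: g hom => [|p0 g] hom s0; first by rewrite big_nil.
transitivity ((par (lroot p0.2) == None)%:R * \sum_(p <- p0 :: g) p.1 * (chi par p.2)%:R : k);
  last by rewrite s0 mulr0.
rewrite mulr_sumr.
apply: eq_big_seq => p pg; rewrite /pi mulrCA; congr (_ %:R * _).
by have [|-> _] := hom p p0 pg; rewrite ?mem_head.
Qed.

Fixpoint magma_term (r : rose) : tree unit :=
  let: Rose x rs := r in foldr (fun r' acc => Node tt acc (magma_term r')) (Leaf x) rs.

Lemma lroot_mag r : lroot (magma_term r) = root r.
Proof. by case: r => x rs /=; elim: rs. Qed.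

Lemma perm_leaves_mag r : perm_eq (leaves (magma_term r)) (labels r).
Proof.
elim/rose_ind': r => x; elim=> // r rs IHrs IH.
have hr : perm_eq (leaves (magma_term r)) (labels r) by apply: IH; rewrite mem_head.
have hrs : perm_eq (leaves (magma_term (Rose x rs))) (labels (Rose x rs)).
  by apply: IHrs => r' h; apply: IH; rewrite inE h orbT.
apply: perm_trans (perm_cat hrs hr) _; rewrite /= perm_cons perm_catC //.
Qed.

Lemma chi_mag par r : uniq (labels r) -> (forall e, e \in edges r -> par e.1 = Some e.2) ->
  chi par (magma_term r) = 1%N.
Proof.
elim/rose_ind': r => x; elim=> // r rs IHrs IH ur pe.
have ur' := ur; rewrite /= cat_uniq mem_cat negb_or -!andbA in ur'.
case/and5P: ur' => xr xrs u1 dis u2.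
have -> : chi par (magma_term (Rose x (r :: rs))) = (chi par (magma_term (Rose x rs)) * chi par (magma_term r) *
  (if par (lroot (magma_term r)) is Some v then count_mem v (leaves (magma_term (Rose x rs))) else 0))%N by [].
have -> : chi par (magma_term (Rose x rs)) = 1%N.
  apply: IHrs => [r' h||e er]; first by apply: IH; rewrite inE h orbT.
    by rewrite /= xrs.
  by apply: pe; rewrite /= inE mem_cat er !orbT.
have -> : chi par (magma_term r) = 1%N.
  apply: IH => [||e er] //; first exact: mem_head.
  by apply: pe; rewrite /= inE mem_cat er orbT.
rewrite lroot_mag (pe (root r, x)) ?mem_head //=.
rewrite (seq.permP (perm_leaves_mag (Rose x rs))) /= eqxx (count_memPn _) //.
Qed.

Lemma dep_labels (dep : nat -> nat) r : (forall e, e \in edges r -> dep e.1 = (dep e.2).+1) ->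
  forall w, w \in labels r -> (dep (root r) <= dep w)%N.
Proof.
elim/rose_ind': r => x rs IH de w; rewrite inE => /predU1P[->|] //.
case/flatten_mapP => r rrs wr.
have er : (root r, x) \in edges (Rose x rs).
  by apply/flatten_mapP; exists r; rewrite ?mem_head.
have := IH r rrs _ w wr => /(_ _) h.
apply: ltnW; rewrite -(de _ er); apply: h => e eer; apply: de.
by apply/flatten_mapP; exists r; rewrite // inE eer orbT.
Qed.

(** When a child of x is attached, the leaves gathered so far are x and the subtrees of the siblings
    attached before it; apart from x, these lie strictly deeper than x. *)
Lemma chi_mag_neq0 par (dep : nat -> nat) r :
  (forall e, e \in edges r -> dep e.1 = (dep e.2).+1) -> chi par (magma_term r) != 0%N ->
  forall e, e \in edges r -> exists2 u, par e.1 = Some u & u = e.2 \/ (dep e.2 < dep u)%N.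
Proof.
elim/rose_ind': r => x; elim=> // r rs IHrs IH de.
have -> : chi par (magma_term (Rose x (r :: rs))) = (chi par (magma_term (Rose x rs)) * chi par (magma_term r) *
  (if par (lroot (magma_term r)) is Some v then count_mem v (leaves (magma_term (Rose x rs))) else 0))%N by [].
rewrite !muln_eq0 !negb_or lroot_mag => /andP[/andP[c1 c2] c3] e.
have des e' : e' \in edges (Rose x rs) -> dep e'.1 = (dep e'.2).+1.
  by move=> h; apply: de; rewrite /= inE mem_cat h !orbT.
rewrite [edges _]/= inE mem_cat => /predU1P[-> /=|/orP[er|ers]].
- case: (par (root r)) c3 => // v; rewrite (seq.permP (perm_leaves_mag (Rose x rs))).
  rewrite -lt0n -has_count has_pred1 inE => /predU1P[->|]; first by exists x; [|left].
  case/flatten_mapP => r' r'rs vr'; exists v => //; right.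
  have er' : (root r', x) \in edges (Rose x rs).
    by apply/flatten_mapP; exists r'; rewrite ?mem_head.
  have := des _ er'; rewrite /= => <-; apply: (dep_labels _ vr') => e' e'r.
  by apply: des; apply/flatten_mapP; exists r'; rewrite // inE e'r orbT.
- apply: (IH r (mem_head _ _) _ c2) => // e' h; apply: de.
  by rewrite /= inE mem_cat h orbT.
- apply: (IHrs _ des c1) => // r' h; apply: IH.
  by rewrite inE h orbT.
Qed.

End Chi.

Section Depth.
Variables (n : nat).

(** Counts the proper ancestors of v; n terms capture them all in a rooted tree, where every orbit
    dies within n steps. *)
Definition depth (par : nat -> option nat) (v : nat) : nat :=
  (\sum_(d < n) (iter d.+1 (obind par) (Some v) != None))%N.

Lemma iter_obind_succ par d (v : nat) : iter d.+1 (obind par) (Some v) = iter d (obind par) (par v).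
Proof. by rewrite iterSr. Qed.

Lemma depth_root par v : par v = None -> depth par v = 0%N.
Proof.
move=> pi_row; rewrite /depth big1 // => d _; by rewrite iter_obind_succ pi_row iter_None.
Qed.

Lemma depth_par par r v u : rooted_at n par r -> par v = Some u -> depth par v = (depth par u).+1.
Proof.
case=> rn _ _ parn parI pi_row; have [_ un] := parn _ _ pi_row.
rewrite /depth; under eq_bigr => d _ do rewrite iter_obind_succ pi_row.
case: n rn parI un => // m _ parI un.
have last0 : obind par (iter m (obind par) (Some u)) = None by apply: (parI u un).
rewrite [in RHS]big_ord_recr /= last0 addn0; rewrite big_ord_recl /= add1n; by [].
Qed.

Definition weight (h : rtree n) : nat := (\sum_(i < n) depth (fpar (val h)) i)%N.

Lemma edges_rose_of (h : rtree n) v w : fpar (val h) v = Some w -> (v, w) \in edges (rose_of h).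
Proof.
move=> pi_row; have [vn wn] := fpar_lt pi_row; have [_ pr0 _ _ _] := rooted_troot h.
have : v \in labels (rose_of h) by rewrite (perm_mem (labels_rose_of h)) mem_iota.
rewrite labels_edges root_build inE => /predU1P[vr|/mapP[[a b] ab e]].
  by rewrite vr pr0 in pi_row.
by have := edges_build ab; rewrite /= -[a]e pi_row => -[->]; rewrite [v]e.
Qed.

Lemma chi_rose_of (h : rtree n) : chi (fpar (val h)) (magma_term (rose_of h)) = 1%N.
Proof.
apply: chi_mag; first by rewrite (perm_uniq (labels_rose_of h)) iota_uniq.
by move=> e; apply: edges_build.
Qed.

(* Every child of x can only move to x itself or into the subtree of a sibling, that is, down. *)
Lemma chi_rose_of_neq0 (g h : rtree n) : fpar (val h) (troot g) = None ->
  chi (fpar (val h)) (magma_term (rose_of g)) != 0%N -> h = g \/ (weight g < weight h)%N.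
Proof.
move=> hroot hchi; have rg := rooted_troot g; have rh := rooted_troot h.
have dg e : e \in edges (rose_of g) ->
    depth (fpar (val g)) e.1 = (depth (fpar (val g)) e.2).+1.
  by move=> /edges_build pe; apply: (depth_par rg pe).
have key v w : fpar (val g) v = Some w -> exists2 u, fpar (val h) v = Some u &
    u = w \/ (depth (fpar (val g)) w < depth (fpar (val g)) u)%N.
  by move=> /edges_rose_of; apply: (chi_mag_neq0 dg hchi).
(* Induction on the depth in h: if v has parent w in g and u in h, then the depth of w in g is at
   most that of u in g, which is at most that of u in h. *)
have le v : (v < n)%N -> (depth (fpar (val g)) v <= depth (fpar (val h)) v)%N.
  move E : (depth (fpar (val h)) v) => d; elim/ltn_ind: d v E => d IH v E vn.
  case Eg : (fpar (val g) v) => [w|]; last by rewrite depth_root.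
  have [u hu uw] := key _ _ Eg; have [_ un] := fpar_lt hu.
  rewrite (depth_par rg Eg); rewrite (depth_par rh hu) in E.
  have lt : (depth (fpar (val h)) u < d)%N by rewrite -E.
  have := IH _ lt u erefl un; rewrite -E ltnS; apply: leq_trans.
  by case: uw => [->|/ltnW].
(* Equal sums force equality termwise, and a vertex whose parent had moved would be strictly deeper
   in h than in g. *)
have := @leqif_sum 'I_n predT _ _ _ (fun i _ => leqif_eq (le i (ltn_ord i))).
rewrite -/(weight g) -/(weight h) => -[wle weq].
case: (ltngtP (weight g) (weight h)) wle weq => // [_ _ _|_ _ /esym/forallP dE]; first by right.
left; apply/val_inj/ffunP => i; apply: (inj_omap val_inj).
rewrite -!fparE; case Eg : (fpar (val g) i) => [w|].
  have [u hu] := key _ _ Eg; rewrite hu => -[->|] //.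
  have := dE i; rewrite /= (depth_par rg Eg) (depth_par rh hu) eqSS => /eqP ->.
  by have [_ un] := fpar_lt hu; rewrite ltnNge le.
have [_ _ gr _ _] := rg; have e := gr i (ltn_ord i) Eg.
by move: hroot; rewrite -e => ->.
Qed.

End Depth.

(** A nonzero row vector killed by [A] is tested in a column i of minimal weight in its support:
    only the diagonal entry survives there. Measuring by weights avoids choosing an order on the
    indices. *)
Lemma unitriangular_unitmx (k : fieldType) N (A : 'M[k]_N) (w : 'I_N -> nat) :
  (forall i, A i i = 1) -> (forall i j, A i j != 0 -> j = i \/ (w i < w j)%N) ->
  A \in unitmx.
Proof.
move=> A1 Aw; rewrite -row_free_unit; apply: inj_row_free => v vA.
apply/eqP; apply: contraT => /rV0Pn[i0 vi0].
case: (@arg_minnP _ i0 (fun i => v 0 i != 0) w vi0) => i vi imin.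
have /matrixP/(_ 0 i) := vA; rewrite !mxE (bigD1 i) //= A1 mulr1 big1 ?addr0 => [v0|j ji].
  by rewrite v0 eqxx in vi.
have [->|vj] := eqVneq (v 0 j) 0; first by rewrite mul0r.
have [->|/Aw[e|lt]] := eqVneq (A j i) 0; first by rewrite mulr0.
  by rewrite e eqxx in ji.
by have := imin j vj; rewrite leqNgt lt.
Qed.

(** A binary tree has one vertex fewer than leaves; hence the Lie filtration is finite in each
    arity. *)
Lemma nbrk_lt_size t : (nbrk t < size (leaves t))%N.
Proof.
elim: t => //= b l IHl r IHr; rewrite size_cat.
have aux (b' x y x' y' : nat) : (b' <= 1 -> x < x' -> y < y' -> b' + x + y < x' + y')%N by lia.
by apply: aux => //; case: (b).
Qed.

Lemma all_cscale (k : fieldType) (L : eqType) (A : pred (tree L)) a (c : comb k L) :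
  all (fun p => A p.2) (cscale a c) = all (fun p => A p.2) c.
Proof. by rewrite all_map. Qed.

Lemma all_csub (k : fieldType) (L : eqType) (A : pred (tree L)) (c d : comb k L) :
  all (fun p => A p.2) (csub c d) = all (fun p => A p.2) c && all (fun p => A p.2) d.
Proof. by rewrite all_cat all_cscale. Qed.

Lemma in_span_gen (k : fieldType) (L : eqType) (G : comb k L -> Prop) g : G g -> in_span G g.
Proof.
move=> Gg; exists [:: (1, g)]; split=> [p|t]; first by rewrite inE => /eqP ->.
by rewrite /= cats0 coef_cscale mul1r.
Qed.

Section EvComb.
Variable k : fieldType.

Lemma coef_ev_cat (c d : comb k bool) :
  coef (ev_comb (c ++ d)) =1 (fun t => coef (ev_comb c) t + coef (ev_comb d) t).
Proof. by move=> t; rewrite /ev_comb map_cat flatten_cat coefc_cat. Qed.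

Lemma coef_ev_lin (c : comb k bool) t :
  coef (ev_comb c) t = lin (fun u => evf k u t : k^o) c.
Proof.
elim: c => [|p c IH]; first by rewrite coef_ev_nil lin_nil.
by rewrite coef_ev_cons lin_cons IH.
Qed.

Lemma coef_ev_ext (c d : comb k bool) : coef c =1 coef d -> coef (ev_comb c) =1 coef (ev_comb d).
Proof. by move=> cd t; rewrite !coef_ev_lin; apply: (@lin_ext k bool k^o). Qed.

Lemma ev_comb_span (G : comb k bool -> Prop) (G' : (tree unit -> k) -> Prop) x :
  (forall g, G g -> spn G' (coef (ev_comb g))) -> in_span G x -> spn G' (coef (ev_comb x)).
Proof.
move=> GG' [gs [Ggs xE]]; apply: (spn_ext (coef_ev_ext xE)) => {x xE}.
elim: gs Ggs => [|p gs IH] Ggs /=; first by apply: spn0; apply: coef_ev_nil.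
have Gp : G p.2 by apply: Ggs; rewrite mem_head.
have {}IH := IH (fun q h => Ggs q (mem_behead (s := p :: gs) h)).
apply: (spn_lin (a := p.1) (GG' _ Gp) IH) => t; rewrite coef_ev_cat; congr (_ + _).
rewrite !coef_ev_lin; exact: (@lin_cscale k bool k^o).
Qed.

Lemma leaves_ev (t : tree bool) p : p \in ev k t -> perm_eq (leaves p.2) (leaves t).
Proof.
elim: t p => [i|b l IHl r IHr] p /=; first by rewrite inE => /eqP ->.
case/flatten_mapP => p1 /IHl h1 /flatten_mapP[p2 /IHr h2].
rewrite !inE => /orP[] /eqP -> /=; first exact: perm_cat.
by rewrite perm_catC; apply: perm_cat.
Qed.

Lemma all_arity_ev n t : arity n t -> all_arity n (ev k t).
Proof. by move=> at_; apply/allP => p /leaves_ev h; apply: perm_trans h at_. Qed.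

Lemma all_arity_ev_comb n (x : comb k bool) : all_arity n x -> all_arity n (ev_comb x).
Proof.
move=> ax; apply/allP => _ /flatten_mapP[p /(allP ax) /all_arity_ev /allP h /mapP[p' /h ? ->]].
by [].
Qed.

Lemma prelie_rels_leaves r : r \in prelie_rels k ->
  {in r &, forall p q, perm_eq (leaves p.2) (leaves q.2)}.
Proof.
move=> rR p q pr qr.
have : all (fun r => all (fun p => all (fun q =>
    perm_eq (leaves p.2) (leaves q.2)) r) r) (prelie_rels k) by [].
by move=> /allP/(_ _ rR)/allP/(_ _ pr)/allP/(_ _ qr).
Qed.

Lemma arity_perm (L L' : eqType) n (t : tree L) (u : tree L') :
  perm_eq (leaves t) (leaves u) -> arity n t = arity n u.
Proof. by move=> tu; rewrite /arity (permPl tu). Qed.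

Lemma ev_neq0 (t : tree bool) : exists p, p \in ev k t.
Proof.
elim: t => [i|b l [p pl] r [q qr]] /=; first by exists (1, Leaf i); rewrite inE.
exists (p.1 * q.1, Node tt p.2 q.2).
by apply/flatten_mapP; exists p => //; apply/flatten_mapP; exists q; rewrite // mem_head.
Qed.

(** The generators of [GF] are homogeneous in the multiset of leaves, so projection to arity n turns
    them into generators of [Fgen]. *)
Lemma GF_Fgen n j (v : comb k unit) : all_arity n v -> GF j (coef v) -> in_span (@Fgen k n j) v.
Proof.
move=> av gv.
have sv : in_span (fun c => pgen (prelie_rels k) c \/ exists2 t, (j <= nbrk t)%N & c = ev k t) v.
  apply/in_spanE; apply: spn_sub_gen gv => f [[c pc fE]|[t jt fE]].
    by exists c => //; left.
  by exists (ev k t) => //; right; exists t.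
apply: in_span_sub (in_span_all (A := arity n) _ av sv) => [g [[pg|[t jt ->]] ag]|g gG p q pg qg].
- by right; apply: pgen_ideal_gen ag.
- left; exists t; split=> //; have [p pt] := ev_neq0 t.
  by rewrite -(arity_perm n (leaves_ev pt)); apply: (allP ag).
apply: arity_perm; case: gG pg qg => [/(pgen_leaves prelie_rels_leaves)|[t _ ->] /leaves_ev pt /leaves_ev qt].
  exact.
by rewrite (permPl pt) perm_sym.
Qed.

Lemma fman_rels_nil : [::] \notin fman_rels k.
Proof. by []. Qed.

Lemma fman_ideal_pgen n (x : comb k bool) : all_arity n x ->
  in_span (pgen (fman_rels k)) x -> in_span (@fman_ideal k n) x.
Proof.
move=> ax sx; apply: in_span_sub (in_span_all (A := arity n) _ ax sx) => [g [pg ag]|g pg p q gp gq].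
  exact: pgen_ideal_gen.
by apply: arity_perm; apply: (pgen_fman_leaves pg).
Qed.

Lemma pgen_fman_ideal n (x : comb k bool) :
  in_span (@fman_ideal k n) x -> in_span (pgen (fman_rels k)) x.
Proof. by apply: in_span_sub => g; apply: ideal_gen_pgen. Qed.

Lemma ideal_Fgen n j (x : comb k bool) : all_arity n x -> all (fun p => nbrk p.2 == j) x ->
  in_span (pgen (fman_rels k)) x -> in_span (@Fgen k n j.+1) (ev_comb x).
Proof.
move=> ax dx sx; apply: GF_Fgen; first exact: all_arity_ev_comb.
have := in_span_all (A := fun t => nbrk t == j) _ dx sx.
move=> /(_ (fun g pg p q gp gq => congr1 (eq_op^~ j) (pgen_fman_nbrk pg gp gq))).
apply: ev_comb_span => g [pg /allP dg].
have [p gp] := pgen_neq0 fman_rels_nil pg.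
by rewrite -(eqP (dg p gp)); apply: GF_fman.
Qed.

End EvComb.

(** * Bases of PreLie(n) and FMan(n) *)

Section Main.
Variables (k : fieldType) (chark0 : [pchar k] =i pred0) (n : nat).
Local Notation N := #|{: rtree n}|.

Definition nth_rtree (i : 'I_N) : rtree n := enum_val i.
Definition nf (i : 'I_N) : tree bool := om (rose_of (nth_rtree i)).
(** The expansion of a magma monomial in the rooted-tree model of PreLie(n); [evrow] is the same for
    tree tensors. *)
Definition pi_row (u : tree unit) : 'rV[k]_N := \row_i pi k (fpar (val (nth_rtree i))) u.
Definition evrow (t : tree bool) : 'rV[k]_N := lin pi_row (ev k t).

Lemma arity_nf i : arity n (nf i).
Proof. exact: perm_trans (perm_leaves_om _) (labels_rose_of _). Qed.

Lemma lin_pv_pgen g : pgen (prelie_rels k) g -> lin pi_row g = 0.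
Proof.
move=> pg; apply/rowP => i; rewrite summxE mxE -[RHS](pi_pgen (fpar (val (nth_rtree i))) pg).
by apply: eq_bigr => p _; rewrite !mxE.
Qed.

Lemma lin_pv_ev (x : comb k bool) : lin pi_row (ev_comb x) = lin evrow x.
Proof.
elim: x => [|p x IH]; first by rewrite !lin_nil.
by rewrite /ev_comb /= lin_cat lin_cscale -/(ev_comb x) IH lin_cons.
Qed.

Definition degge j (w : 'rV[k]_N) := exists2 x : comb k bool,
  all (fun p => arity n p.2 && (j <= nbrk p.2)%N) x & w = lin evrow x.

Lemma degge_lin j a w w' : degge j w -> degge j w' -> degge j (a *: w + w').
Proof.
case=> x ax -> [x' ax' ->]; exists (cscale a x ++ x'); last by rewrite lin_cat lin_cscale.
by rewrite all_cat ax' andbT (all_cscale (fun t => arity n t && (j <= nbrk t)%N)).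
Qed.

Lemma degge_Fgen j v : in_span (@Fgen k n j) v -> degge j (lin pi_row v).
Proof.
apply: lin_span; first by exists [::]; rewrite ?lin_nil.
- exact: degge_lin.
- move=> g [[t [at_ [jt ->]]]|ig].
    by exists [:: (1, t)]; rewrite /= ?at_ ?jt // lin_cons lin_nil scale1r addr0.
  by exists [::]; rewrite // lin_nil lin_pv_pgen //; apply: ideal_gen_pgen ig.
Qed.

Definition nfcomb (c : 'I_N -> k) : comb k bool := [seq (c i, nf i) | i <- enum 'I_N].

Lemma all_arity_nfcomb c : all_arity n (nfcomb c).
Proof. by rewrite /all_arity all_map; apply/allP => i _; apply: arity_nf. Qed.

Lemma lin_nfcomb (V : lmodType k) (phi : tree bool -> V) c :
  lin phi (nfcomb c) = \sum_i c i *: phi (nf i).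
Proof. by rewrite /lin big_map big_enum. Qed.

Lemma coef_lin (L : eqType) (c : comb k L) t : coef c t = lin (fun u => single k u t : k^o) c.
Proof. by elim: c => [|p c IH]; rewrite ?coefc_nil ?lin_nil // coefc_cons lin_cons IH. Qed.

Lemma sp_comb P f : sp (k := k) P f -> exists2 c : comb k bool, (forall p, p \in c -> P p.2) &
  spn (fun g => exists2 c, pgen (fman_rels k) c & g =1 coef c) (fun t => f t - coef c t).
Proof.
elim=> {f} [f f0|a g f h Gg _ [c Pc sc] hE].
  by exists [::] => //; apply: spn0 => t; rewrite f0 coefc_nil subr0.
case: Gg => [Jg|[t Pt gE]].
  by exists c => //; apply: (spnD Jg sc) => t; rewrite hE addrA.
exists ((a, t) :: c) => [p|].
  by rewrite inE => /predU1P[->|/Pc].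
by apply: spn_ext sc => u; rewrite hE coefc_cons gE /=; ring.
Qed.

Lemma nf_span (x : comb k bool) : all_arity n x ->
  exists c, in_span (pgen (fman_rels k)) (csub x (nfcomb c)).
Proof.
elim: x => [_|[a t] x IH /andP[at_ /IH[c sc]]].
  exists (fun=> 0); exists [::]; split=> // t.
  rewrite coefc_nil coef_csub coefc_nil coef_lin lin_nfcomb big1 ?subr0 // => i _.
  exact: mul0r.
have ut : uniq (leaves t) by rewrite (perm_uniq at_) iota_uniq.
have [d nd sd] := sp_comb (spt_normal_form k ut).
have [e eE] : exists e, coef d =1 coef (nfcomb e).
  elim: d nd {sd} => [|[b u] d IHd] nd.
    exists (fun=> 0) => u; rewrite coefc_nil coef_lin lin_nfcomb big1 // => i _; exact: mul0r.
  have [|e eE] := IHd; first by move=> p pd; apply: nd; rewrite inE pd orbT.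
  have [|r [cr lr _ uE]] := nd (b, u); first by rewrite mem_head.
  have [h hE] := rose_of_surj cr (perm_trans lr at_).
  exists (fun i => b * (i == enum_rank h)%:R + e i) => v.
  rewrite coefc_cons eE !coef_lin !lin_nfcomb (bigD1 (enum_rank h)) //= [in RHS](bigD1 (enum_rank h)) //=.
  rewrite eqxx mulr1 scalerDl -!addrA; congr (_ + _).
    by rewrite /nf /nth_rtree enum_rankK hE -[om r]uE.
  congr (_ + _); apply: eq_bigr => i /negPf->; by rewrite mulr0 add0r.
exists (fun i => a * e i + c i); apply/in_spanE.
move/in_spanE: sc => sc; apply: (spn_lin (a := a) sd sc) => u.
rewrite !coef_csub coefc_cons eE !coef_lin !lin_nfcomb.
have -> : \sum_i (a * e i + c i) *: (single k (nf i) u : k^o) =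
  a * (\sum_i e i *: (single k (nf i) u : k^o)) + \sum_i c i *: (single k (nf i) u : k^o).
  rewrite mulr_sumr -big_split; apply: eq_bigr => i _ /=.
  by rewrite scalerDl -scalerA.
by rewrite /= opprD addrACA mulrBr.
Qed.

Lemma nf_span_homogeneous j (x : comb k bool) : all_arity n x -> all (fun p => nbrk p.2 == j) x ->
  exists2 c : 'I_N -> k, (forall i, c i != 0 -> nbrk (nf i) = j) &
    in_span (pgen (fman_rels k)) (csub x (nfcomb c)) /\
    in_span (@Fgen k n j.+1) (ev_comb (csub x (nfcomb c))).
Proof.
move=> ax dx; have [c sc] := nf_span ax.
pose c' i := if nbrk (nf i) == j then c i else 0.
have s' : in_span (fun g => pgen (fman_rels k) g /\ all (fun p => nbrk p.2 == j) g)
    [seq p <- csub x (nfcomb c) | nbrk p.2 == j].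
  apply: (in_span_filter (A := fun t => nbrk t == j)) sc => g pg p p' gp gp'.
  by rewrite (pgen_fman_nbrk pg gp gp').
have cE : coef (csub x (nfcomb c')) =1 coef [seq p <- csub x (nfcomb c) | nbrk p.2 == j].
  move=> t; rewrite (coef_filter (fun t => nbrk t == j)) !coef_csub mulrBr.
  rewrite -(coef_filter (fun t => nbrk t == j)) (all_filterP dx); congr (_ - _).
  rewrite !coef_lin !lin_nfcomb mulr_sumr; apply: eq_bigr => i _.
  rewrite /c' /single; case: (eqVneq (nf i) t) => [<-|ne].
    by case: ifP; rewrite ?mul1r ?mul0r ?scale0r.
  by rewrite scaler0 [_ *: _]mulr0 mulr0.
have s'' : in_span (fun g => pgen (fman_rels k) g /\ all (fun p => nbrk p.2 == j) g)
    (csub x (nfcomb c')).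
  by case: s' => gs [Ggs E]; exists gs; split=> // t; rewrite cE.
exists c' => [i|]; first by rewrite /c'; case: (nbrk (nf i) =P j) => // _; rewrite eqxx.
split; first by apply: in_span_sub s'' => g [].
apply: GF_Fgen.
  apply: all_arity_ev_comb; rewrite /all_arity (all_csub (arity n)).
  by rewrite -/(all_arity n x) ax; apply: all_arity_nfcomb.
apply: ev_comb_span s'' => g [pg /allP dg].
have [p gp] := pgen_neq0 (fman_rels_nil k) pg.
by rewrite -(eqP (dg p gp)); apply: GF_fman.
Qed.

Definition Qmx : 'M[k]_N := \matrix_i evrow (nf i).

Lemma row_Qmx i : row i Qmx = evrow (nf i).
Proof. exact: rowK. Qed.

(** Built from normal forms with at least j brackets, whereas [degge j] admits all such tree
    tensors; [Fdeg_degge] compares the two. *)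
Definition Fdeg j (w : 'rV[k]_N) := exists2 c : 'rV[k]_N, w = c *m Qmx &
  forall i, (nbrk (nf i) < j)%N -> c 0 i = 0.

Lemma Fdeg_lin j a w w' : Fdeg j w -> Fdeg j w' -> Fdeg j (a *: w + w').
Proof.
case=> c -> c0 [c' -> c0']; exists (a *: c + c'); first by rewrite mulmxDl scalemxAl.
by move=> i ij; rewrite !mxE c0 ?c0' // mulr0 addr0.
Qed.

Lemma Fdeg0 j : Fdeg j 0.
Proof. by exists 0 => [|i _]; rewrite ?mul0mx ?mxE. Qed.

Lemma Fdeg_le j j' w : (j' <= j)%N -> Fdeg j w -> Fdeg j' w.
Proof. by move=> jj [c wE c0]; exists c => // i ij; apply: c0; apply: leq_trans jj. Qed.

Lemma Fdeg_lin_q j (x : comb k bool) : (forall p, p \in x -> Fdeg j (evrow p.2)) -> Fdeg j (lin evrow x).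
Proof.
elim: x => [_|p x IH Fx]; first by rewrite lin_nil; apply: Fdeg0.
rewrite lin_cons; apply: Fdeg_lin; first by apply: Fx; rewrite mem_head.
by apply: IH => p' px; apply: Fx; rewrite inE px orbT.
Qed.

(** [t] is rewritten into normal forms of the same degree; the error has more brackets and falls to
    the induction on n minus the bracket count. *)
Lemma Fdeg_q t : arity n t -> Fdeg (nbrk t) (evrow t).
Proof.
move: {2}(n - nbrk t)%N (leqnn (n - nbrk t)) => m.
elim: m t => [|m IH] t tm at_.
  have := nbrk_lt_size t; rewrite (perm_size at_) size_iota => lt.
  by move: tm; rewrite leqn0 subn_eq0 leqNgt lt.
have at1 : all_arity n [:: ((1 : k), t)] by rewrite /= at_.
have [|c cd [_ sc]] := nf_span_homogeneous (j := nbrk t) at1; first by rewrite /= eqxx.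
have := degge_Fgen sc; rewrite lin_pv_ev lin_csub lin_cons lin_nil addr0 scale1r => -[x ax E].
have -> : evrow t = lin evrow (nfcomb c) + lin evrow x by rewrite -E addrCA subrr addr0.
rewrite -[lin evrow (nfcomb c)]scale1r; apply: Fdeg_lin.
  exists (\row_i c i) => [|i]; first by rewrite lin_nfcomb mulmx_sum_row; apply: eq_bigr => i _; rewrite mxE row_Qmx.
  by rewrite mxE; apply: contraTeq => /cd ->; rewrite ltnn.
apply: Fdeg_lin_q => p /(allP ax)/andP[ap tp]; apply: (Fdeg_le (ltnW tp)).
by apply: IH => //; move: tp tm; lia.
Qed.

Lemma Fdeg_degge j w : degge j w -> Fdeg j w.
Proof.
case=> x ax ->; apply: Fdeg_lin_q => p /(allP ax)/andP[ap jp].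
exact: Fdeg_le jp (Fdeg_q ap).
Qed.

Lemma two_neq0 : (2 : k) != 0.
Proof. by move/pcharf0P: chark0 => ->. Qed.

(** At each vertex, a.b is half the sum of a o b and [a,b]. *)
Lemma span_ev (u : tree unit) : spn (fun f => exists2 t, perm_eq (leaves t) (leaves u) & f =1 evf k t)
  (single k u).
Proof.
elim: u => [i|[] l IHl r IHr].
  by apply: spn_gen; exists (Leaf i) => // t; rewrite evf_leaf.
apply: spn_ext; first exact: single_node.
apply: (spn_map (dotf_linl _) _ IHl) => f [t tl fE].
apply: (spn_map (dotf_linr _) _ IHr) => g [t' tr gE].
have G b : spn (fun f => exists2 t, perm_eq (leaves t) (leaves (Node tt l r)) & f =1 evf k t) (symf b f g).
  apply: spn_gen; exists (Node b t t'); first exact: perm_cat.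
  by move=> v; rewrite evf_node; apply: symf_ext.
have := spn_add (G false) (G true) (frefl _) => /(spn_scale (a := 2^-1)) h; apply: h => v.
rewrite /symf; have := two_neq0 => h2; field; exact: h2.
Qed.

Lemma pv_Qmx u : arity n u -> (pi_row u <= Qmx)%MS.
Proof.
move=> au; have -> : pi_row u = lin pi_row [:: (1, u)] by rewrite lin_cons lin_nil scale1r addr0.
have : in_span (fun c => exists2 t, arity n t & c = ev k t) [:: ((1 : k), u)].
  apply/in_spanE; apply: (@spn_ext _ _ _ (single k u)) => [t|].
    by rewrite coefc_cons coefc_nil mul1r addr0.
  apply: spn_sub_gen (span_ev u) => f [t tu fE]; exists (ev k t) => //; exists t => //.
  by rewrite (arity_perm n tu).
apply: (lin_span (P := fun v => (v <= Qmx)%MS)) => [|a x y|]; first exact: sub0mx.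
- by move=> sx sy; rewrite addmx_sub ?scalemx_sub.
- move=> _ [t at_ ->]; have [c cE _] := Fdeg_q at_; by rewrite -/(evrow t) cE submxMl.
Qed.

(** The unitriangular matrix [M] of magma monomials has its rows in the row space of [Qmx], because
    monomials are combinations of tree tensors and these of normal forms. As [Qmx] is square,
    spanning gives invertibility. *)
Lemma Qmx_unit : Qmx \in unitmx.
Proof.
pose M : 'M[k]_N := \matrix_i pi_row (magma_term (rose_of (nth_rtree i))).
have ME i j : M i j = (fpar (val (nth_rtree j)) (troot (nth_rtree i)) == None)%:R *
    (chi (fpar (val (nth_rtree j))) (magma_term (rose_of (nth_rtree i))))%:R.
  by rewrite !mxE /pi lroot_mag root_build.
have uM : M \in unitmx.
  apply: (@unitriangular_unitmx _ _ _ (fun i => weight (nth_rtree i))) => [i|i j].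
    by rewrite ME chi_rose_of; have [_ -> _ _ _] := rooted_troot (nth_rtree i); rewrite mulr1.
  rewrite ME; case: (fpar _ _ =P None) => [r0|]; last by rewrite mul0r eqxx.
  rewrite mul1r => nz; have : chi (fpar (val (nth_rtree j))) (magma_term (rose_of (nth_rtree i))) != 0%N.
    by apply: contraNneq nz => ->.
  by case/(chi_rose_of_neq0 r0) => [/enum_val_inj|]; [left|right].
rewrite -row_full_unit -sub1mx; apply: submx_trans (_ : (M <= _)%MS).
  by rewrite sub1mx row_full_unit.
apply/row_subP => i; rewrite rowK; apply: pv_Qmx.
exact: perm_trans (perm_leaves_mag _) (labels_rose_of _).
Qed.

(* Coordinates of the class of t in the degree nbrk t part of the associated graded. *)
Definition grcoord (t : tree bool) : 'rV[k]_N :=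
  \row_i (if nbrk (nf i) == nbrk t then (evrow t *m invmx Qmx) 0 i else 0).

Lemma Fdeg_coord j w i : Fdeg j w -> (nbrk (nf i) < j)%N -> (w *m invmx Qmx) 0 i = 0.
Proof. by case=> c -> c0 ij; rewrite mulmxK ?Qmx_unit // c0. Qed.

(** [grcoord] selects a degree that depends on its argument, so it factors through [evrow] on
    homogeneous combinations. *)
Lemma lin_kap j (x : comb k bool) i : all (fun p => nbrk p.2 == j) x ->
  (lin grcoord x) 0 i = if nbrk (nf i) == j then (lin evrow x *m invmx Qmx) 0 i else 0.
Proof.
elim: x => [_|p x IH /andP[/eqP pj /IH E]]; first by rewrite !lin_nil mul0mx mxE; case: ifP.
rewrite !lin_cons mulmxDl -scalemxAl [LHS]mxE [X in X + _ = _]mxE E /grcoord mxE pj.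
case: ifP => _; last by rewrite mulr0 addr0.
by rewrite [RHS]mxE [X in _ = X + _]mxE.
Qed.

Lemma lin_kap0 j (x : comb k bool) : all (fun p => nbrk p.2 == j) x ->
  in_span (@Fgen k n j.+1) (ev_comb x) -> lin grcoord x = 0.
Proof.
move=> dx /degge_Fgen/Fdeg_degge; rewrite lin_pv_ev => Fx.
apply/rowP => i; rewrite (lin_kap i dx) [RHS]mxE; case: eqP => // ij.
by apply: (Fdeg_coord Fx); rewrite ij.
Qed.

(** A generator of the ideal has a single bracket degree j and evaluates into F^(j+1), whose
    degree-j coordinates vanish. *)
Lemma kap_ideal g : fman_ideal n g -> lin grcoord g = 0.
Proof.
move=> ig; have [_ [_ [_ [_ [_ _ _ ag]]]]] := ig; have pg := ideal_gen_pgen ig.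
have [p gp] := pgen_neq0 (fman_rels_nil k) pg.
have dg : all (fun p' => nbrk p'.2 == nbrk p.2) g.
  by apply/allP => p' gp'; rewrite (pgen_fman_nbrk pg gp gp').
apply: (lin_kap0 dg); apply: ideal_Fgen => //.
exact: in_span_gen.
Qed.

Lemma kap_nf i : grcoord (nf i) = delta_mx 0 i.
Proof.
have qK : evrow (nf i) *m invmx Qmx = delta_mx 0 i by rewrite -row_Qmx rowE mulmxK ?Qmx_unit.
apply/rowP => j; rewrite [LHS]mxE qK !mxE eqxx /=.
by case: (eqVneq j i) => [->|_]; rewrite ?eqxx // if_same.
Qed.

Lemma kap_ideal0 x : in_span (@fman_ideal k n) x -> lin grcoord x = 0.
Proof.
apply: (lin_span (P := fun v => v = 0)) => // [a u v -> ->|]; first by rewrite scaler0 addr0.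
exact: kap_ideal.
Qed.

(** Since [grcoord] kills the ideal and is dual to the normal forms, it reads off the coefficients
    of any expansion. *)
Lemma kap_span x : all_arity n x ->
  in_span (@fman_ideal k n) (csub x (nfcomb (fun i => lin grcoord x 0 i))).
Proof.
move=> ax; have [c sc] := nf_span ax.
have {sc} : in_span (@fman_ideal k n) (csub x (nfcomb c)).
  apply: fman_ideal_pgen sc; rewrite /all_arity (all_csub (arity n)).
  by rewrite -/(all_arity n x) ax; apply: all_arity_nfcomb.
move=> sc; have := kap_ideal0 sc; rewrite lin_csub => /eqP; rewrite subr_eq0 => /eqP ->.
rewrite lin_nfcomb; set c' := fun i => _.
suff : c' =1 c.
  by move=> cc; case: sc => gs [Ggs E]; exists gs; split=> // t; rewrite -E !coef_csub;
    congr (_ - _); congr coef; apply: eq_map => i; rewrite cc.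
move=> i; rewrite /c' summxE (bigD1 i) //= big1 ?addr0 => [|j ji].
  by rewrite kap_nf !mxE !eqxx mulr1.
by rewrite kap_nf !mxE (eq_sym i) (negPf ji) andbF mulr0.
Qed.

Lemma kap_ker x : all_arity n x -> lin grcoord x = 0 -> in_span (@fman_ideal k n) x.
Proof.
move=> ax x0; have [gs [Ggs E]] := kap_span ax; exists gs; split=> // t.
rewrite -E coef_csub [coef (nfcomb _) t]coef_lin lin_nfcomb big1 ?subr0 // => i _.
by rewrite x0 mxE scale0r.
Qed.

Lemma gr_kernel j x : all_arity n x -> all (fun p => nbrk p.2 == j) x ->
  (in_span (@Fgen k n j.+1) (ev_comb x) <-> in_span (@fman_ideal k n) x).
Proof.
move=> ax dx; split=> [sx|sx]; first by apply: kap_ker ax (lin_kap0 dx sx).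
exact: ideal_Fgen (pgen_fman_ideal sx).
Qed.

(** Duality gives independence; for spanning, the difference between [x] and its expansion is killed
    by [Phi]. *)
Lemma basis_mod_dual (Phi : tree bool -> 'rV[k]_N) (bs : seq (comb k bool)) : size bs = N ->
  (forall b, b \in bs -> all_arity n b) ->
  (forall g, fman_ideal n g -> lin Phi g = 0) ->
  (forall i : 'I_N, lin Phi (nth [::] bs i) = delta_mx 0 i) ->
  (forall x, all_arity n x -> lin Phi x = 0 -> in_span (@fman_ideal k n) x) ->
  basis_mod (@fman_ideal k n) n bs.
Proof.
move=> sb ab Phi0 Phib Phik.
have linC (c : nat -> k) : lin Phi (lincomb c bs) = \row_(i < N) c i.
  rewrite /lincomb sb.
  transitivity (\sum_(i <- iota 0 N) c i *: lin Phi (nth [::] bs i)).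
    elim: (iota 0 N) => [|i s IH] /=; first by rewrite lin_nil big_nil.
    by rewrite lin_cat lin_cscale IH big_cons.
  rewrite -[in iota _ N](subn0 N) big_mkord; apply/rowP => j; rewrite summxE mxE (bigD1 j) //=.
  rewrite Phib !mxE !eqxx mulr1 big1 ?addr0 // => i ij.
  by rewrite Phib !mxE (eq_sym j) (negPf ij) andbF mulr0.
split=> // [c sc i ib|x ax].
  have : lin Phi (lincomb c bs) = 0.
    apply: (lin_span (P := fun v => v = 0)) sc => // a u v -> ->; by rewrite scaler0 addr0.
  rewrite sb in ib; move/rowP/(_ (Ordinal ib)); by rewrite linC !mxE.
exists (fun i => if insub i is Some j then lin Phi x 0 j else 0); set c := fun i => _.
apply: Phik.
  rewrite /all_arity (all_csub (arity n)) -/(all_arity n x) ax /=.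
  apply/allP => _ /flatten_mapP[i + /mapP[p' pi ->]]; rewrite mem_iota => /andP[_ ib] /=.
  exact: (allP (ab _ (mem_nth [::] ib)) _ pi).
rewrite lin_csub linC; apply/eqP; rewrite subr_eq0; apply/eqP/rowP => j.
by rewrite mxE /c valK.
Qed.

End Main.

(** Of an expansion of [y], keep the tree tensors with exactly j brackets; the others and the PreLie
    relators already lie in F^(j+1). *)
Lemma gr_surjective (k : fieldType) (n j : nat) (y : comb k unit) :
  in_span (@Fgen k n j) y ->
  exists x : comb k bool, [/\ all_arity n x, all (fun p => nbrk p.2 == j) x &
    in_span (@Fgen k n j.+1) (csub y (ev_comb x))].
Proof.
case=> gs [Ggs yE].
suff [x [ax dx sx]] : exists x : comb k bool, [/\ all_arity n x, all (fun p => nbrk p.2 == j) x &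
    in_span (@Fgen k n j.+1) (csub (flatten [seq cscale p.1 p.2 | p <- gs]) (ev_comb x))].
  exists x; split=> //; case: sx => gs' [G' E]; exists gs'; split=> // t.
  by rewrite -E !coef_csub yE.
elim: gs Ggs {yE} => [|[a g] gs IH] Ggs.
  by exists [::]; split=> //; exists [::]; split=> // t; rewrite coef_csub coef_ev_nil !coefc_nil subr0.
have [|x [ax dx sx]] := IH; first by move=> p pgs; apply: Ggs; rewrite inE pgs orbT.
have add g' : Fgen n j.+1 g' -> in_span (@Fgen k n j.+1)
    (csub (cscale a g' ++ flatten [seq cscale p.1 p.2 | p <- gs]) (ev_comb x)).
  move=> Fg; case: sx => gs' [G' E]; exists ((a, g') :: gs'); split=> [p|t].
    by rewrite inE => /predU1P[-> //|/G'].
  by rewrite /= coefc_cat -E !coef_csub coefc_cat addrA.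
have [[t [at_ [jt gE]]]|ig] := Ggs (a, g) (mem_head _ _); last first.
  by exists x; split=> //; apply: add; right.
move: jt; rewrite leq_eqVlt => /predU1P[jt|jt]; last first.
  by exists x; split=> //; apply: add; left; exists t.
exists ((a, t) :: x); split; [by rewrite /all_arity /= at_|by rewrite /= -jt eqxx|].
case: sx => gs' [G' E]; exists gs'; split=> // u.
rewrite -E !coef_csub coef_ev_cons coefc_cat coef_cscale -[g]/(a, g).2 gE /evf /=; ring.
Qed.

(** * Equivariance *)

Section Relabel.
Variable n : nat.
Implicit Types (s : 'S_n) (h : rtree n).

Definition relt (L : eqType) s (t : tree L) : tree L := tsubst (fun i => Leaf (relabel_nat s i)) t.

Lemma relabel_ord s (i : 'I_n) : relabel_nat s i = val (s i).
Proof. by rewrite /relabel_nat valK. Qed.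

Lemma relabel_ge s i : (n <= i)%N -> relabel_nat s i = i.
Proof. by move=> ni; rewrite /relabel_nat insubN // -leqNgt. Qed.

Lemma relabel_cases (P : nat -> Prop) :
  (forall i : 'I_n, P i) -> (forall i, (n <= i)%N -> P i) -> forall i, P i.
Proof. by move=> P1 P2 i; case: (ltnP i n) => [lt|/P2 //]; apply: (P1 (Ordinal lt)). Qed.

Lemma relabelM s s' i : relabel_nat (s * s')%g i = relabel_nat s' (relabel_nat s i).
Proof.
elim/relabel_cases: i => i; first by rewrite !relabel_ord permM.
by move=> ni; rewrite !relabel_ge.
Qed.

Lemma relabel1 i : relabel_nat (1%g : 'S_n) i = i.
Proof.
elim/relabel_cases: i => i; first by rewrite relabel_ord perm1.
exact: relabel_ge.
Qed.

Lemma relabel_inj s : injective (relabel_nat s).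
Proof. by apply: (can_inj (g := relabel_nat s^-1%g)) => i; rewrite -relabelM mulgV relabel1. Qed.

Lemma leaves_relt (L : eqType) s (t : tree L) :
  leaves (relt s t) = [seq relabel_nat s i | i <- leaves t].
Proof. by elim: t => //= a l -> r ->; rewrite map_cat. Qed.

Lemma reltM (L : eqType) s s' (t : tree L) : relt s' (relt s t) = relt (s * s')%g t.
Proof.
elim: t => [i|a l IHl r IHr]; first by rewrite /relt /= relabelM.
exact: (f_equal2 (Node a) IHl IHr).
Qed.

Lemma relt1 (L : eqType) (t : tree L) : relt (1%g : 'S_n) t = t.
Proof.
elim: t => [i|a l IHl r IHr]; first by rewrite /relt /= relabel1.
exact: (f_equal2 (Node a) IHl IHr).
Qed.

Lemma relabel_lt s i : (relabel_nat s i < n)%N = (i < n)%N.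
Proof.
elim/relabel_cases: i => i; first by rewrite relabel_ord !ltn_ord.
by move=> ni; rewrite relabel_ge.
Qed.

Lemma arity_relt (L : eqType) s (t : tree L) : arity n t -> arity n (relt s t).
Proof.
move=> at_; rewrite /arity leaves_relt; apply: perm_trans (perm_map _ at_) _.
apply: uniq_perm; rewrite ?iota_uniq ?(map_inj_uniq (@relabel_inj s)) ?iota_uniq // => i.
have iE : i = relabel_nat s (relabel_nat s^-1%g i) by rewrite -relabelM mulVg relabel1.
rewrite [in LHS]iE (mem_map (@relabel_inj s)) !mem_iota !add0n /=.
exact: relabel_lt.
Qed.

Lemma nbrk_relt s (t : tree bool) : nbrk (relt s t) = nbrk t.
Proof. by elim: t => //= b l -> r ->. Qed.

Definition actf s h : {ffun 'I_n -> option 'I_n} := [ffun i => omap s (val h (s^-1%g i))].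

Lemma iter_actf s h d (oi : option 'I_n) :
  iter d (fun x => obind (actf s h) x) (omap s oi) = omap s (iter d (fun x => obind (val h) x) oi).
Proof.
elim: d => //= d ->; case: (iter _ _ _) => //= i.
by rewrite ffunE permK.
Qed.

Lemma rooted_actf s h : rooted (actf s h).
Proof.
have /andP[/card1P[r rE] /forallP it] := valP h; apply/andP; split.
  apply/card1P; exists (s r) => i; rewrite !inE ffunE.
  have := rE (s^-1%g i); rewrite !inE => e.
  rewrite (_ : (i == s r) = (s^-1%g i == r)); last by rewrite (canF_eq (permKV s)).
  by rewrite -e; case: (val h _).
apply/forallP => i; have := iter_actf s h n (Some (s^-1%g i)).
by rewrite /= permKV => ->; rewrite (eqP (it _)).
Qed.

Definition act s h : rtree n := exist _ (actf s h) (rooted_actf s h).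

Lemma fpar_act s h i :
  fpar (val (act s h)) (relabel_nat s i) = omap (relabel_nat s) (fpar (val h) i).
Proof.
elim/relabel_cases: i => i.
  rewrite relabel_ord !fparE ffunE permK; case: (val h i) => //= j.
  by rewrite relabel_ord.
by move=> ni; rewrite relabel_ge // /fpar insubN // -leqNgt.
Qed.

Lemma lroot_relt s u : lroot (relt s u) = relabel_nat s (lroot u).
Proof. by elim: u => //= a l ->. Qed.

Lemma chi_relt s h u : chi (fpar (val (act s h))) (relt s u) = chi (fpar (val h)) u.
Proof.
elim: u => //= a l IHl r IHr; rewrite -!/(relt s _) IHl IHr; congr (_ * _)%N.
rewrite lroot_relt fpar_act; case: (fpar _ _) => //= v.
rewrite leaves_relt count_map; apply: eq_count => i /=.
by rewrite (inj_eq (@relabel_inj s)).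
Qed.

Lemma pi_relt (k : fieldType) s h u : pi k (fpar (val (act s h))) (relt s u) = pi k (fpar (val h)) u.
Proof.
rewrite /pi chi_relt lroot_relt fpar_act; congr (_%:R * _).
by case: (fpar _ _).
Qed.

Lemma actM s s' h : act (s * s')%g h = act s' (act s h).
Proof.
apply/val_inj/ffunP => i; rewrite !ffunE invMg permM; case: (val h _) => //= j.
by rewrite permM.
Qed.

Lemma act1 h : act 1%g h = h.
Proof. by apply/val_inj/ffunP => i; rewrite ffunE invg1 perm1; case: (val h i) => //= j; rewrite perm1. Qed.

End Relabel.

Lemma ev_relt (k : fieldType) n (s : 'S_n) t :
  ev k (relt s t) = csubst (fun i => Leaf (relabel_nat s i)) (ev k t).
Proof.
elim: t => //= b l IHl r IHr; rewrite -!/(relt s _) IHl IHr /csubst map_flatten -!map_comp; congr flatten.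
apply: eq_map => p /=; rewrite map_flatten -!map_comp; congr flatten.
Qed.

Lemma pgen_csubst (k : fieldType) (L : eqType) (R : seq (comb k L)) s g :
  pgen R g -> pgen R (csubst s g).
Proof.
have tsubst_comp s' (t : tree L) : tsubst s (tsubst s' t) = tsubst (fun i => tsubst s (s' i)) t.
  by elim: t => //= a l -> r ->.
elim=> [r s' rR|a u {}g _ IH|a u {}g _ IH].
- rewrite (_ : csubst s (csubst s' r) = csubst (fun i => tsubst s (s' i)) r); first exact: pgen_rel.
  by rewrite /csubst -map_comp; apply: eq_map => p /=; rewrite tsubst_comp.
- rewrite (_ : csubst s _ = nodel a (tsubst s u) (csubst s g)); first exact: pgen_l.
  by rewrite /csubst /nodel -!map_comp.
- rewrite (_ : csubst s _ = noder a (tsubst s u) (csubst s g)); first exact: pgen_r.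
  by rewrite /csubst /noder -!map_comp.
Qed.

Section Equivariant.
Variables (k : fieldType) (chark0 : [pchar k] =i pred0) (n : nat).
Local Notation N := #|{: rtree n}|.
Local Notation q := (evrow k n).
Local Notation Qmx := (Qmx k n).
Local Notation grcoord := (grcoord k n).

Definition rk (s : 'S_n) (i : 'I_N) : 'I_N := enum_rank (act s (nth_rtree i)).
(** On row vectors this undoes the relabelling by [s] ([q_relt]), so products come out reversed
    ([PmxM]). *)
Definition Pmx (s : 'S_n) : 'M[k]_N := \matrix_(i, j) (i == rk s j)%:R.

Lemma mul_Pmx (v : 'rV[k]_N) s j : (v *m Pmx s) 0 j = v 0 (rk s j).
Proof.
rewrite mxE (bigD1 (rk s j)) //= mxE eqxx mulr1 big1 ?addr0 // => i ne.
by rewrite mxE (negPf ne) mulr0.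
Qed.

Lemma rkM s s' i : rk (s * s')%g i = rk s' (rk s i).
Proof. by rewrite /rk /nth_rtree enum_rankK actM. Qed.

Lemma PmxM s s' (v : 'rV[k]_N) : v *m Pmx (s * s')%g = v *m Pmx s' *m Pmx s.
Proof. by apply/rowP => j; rewrite !mul_Pmx rkM. Qed.

Lemma pv_relt s u : pi_row k n (relt s u) *m Pmx s = pi_row k n u.
Proof. by apply/rowP => j; rewrite mul_Pmx !mxE /rk /nth_rtree enum_rankK pi_relt. Qed.

Lemma q_relt s t : q (relt s t) *m Pmx s = q t.
Proof.
rewrite /evrow ev_relt /lin big_map mulmx_suml; apply: eq_bigr => p _ /=.
by rewrite -scalemxAl -/(relt s _) pv_relt.
Qed.

(** A relabelled normal form need not be a normal form, but it keeps its number of brackets, and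
    [Fdeg_q] expands it again. *)
Lemma Fdeg_Pmx s j w : Fdeg (n := n) j w -> Fdeg j (w *m Pmx s).
Proof.
case=> c -> c0.
have -> : c *m Qmx *m Pmx s = lin q [seq (c 0 i, relt s^-1%g (nf i)) | i <- enum 'I_N].
  rewrite /lin big_map big_enum /= [c *m _]mulmx_sum_row mulmx_suml; apply: eq_bigr => i _.
  have e : nf i = relt s (relt s^-1%g (nf i)) by rewrite reltM mulVg relt1.
  by rewrite -scalemxAl row_Qmx [in LHS]e q_relt.
have {c0} : forall p, p \in [seq (c 0 i, relt s^-1%g (nf i)) | i <- enum 'I_N] ->
    p.1 = 0 \/ Fdeg j (q p.2).
  move=> _ /mapP[i _ ->] /=; have [ij|ji] := ltnP (nbrk (nf i)) j; first by left; apply: c0.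
  right; apply: (@Fdeg_le _ _ (nbrk (relt s^-1%g (nf i)))); first by rewrite nbrk_relt.
  by apply: Fdeg_q => //; apply/arity_relt/arity_nf.
elim: (map _ _) => [|p x IH] Fx; first by rewrite lin_nil; apply: Fdeg0.
have {}IH := IH (fun p' h => Fx p' (mem_behead (s := p :: x) h)).
by rewrite lin_cons; case: (Fx p (mem_head _ _)) => [->|Fp]; [rewrite scale0r add0r|apply: Fdeg_lin].
Qed.

(* Average of the (not equivariant) isomorphism given by grcoord. *)
Definition Psi (t : tree bool) : 'rV[k]_N :=
  (n`!%:R)^-1 *: \sum_(s : 'S_n) (grcoord (relt s t) *m Qmx *m Pmx s).

Lemma factn_neq0 : (n`!%:R : k) != 0.
Proof. by move/pcharf0P: chark0 => ->; rewrite -lt0n fact_gt0. Qed.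

Lemma Psi_relt s t : Psi (relt s t) *m Pmx s = Psi t.
Proof.
rewrite /Psi -scalemxAl; congr (_ *: _).
rewrite mulmx_suml [RHS](reindex_inj (mulgI s)) /=; apply: eq_bigr => s' _.
by rewrite reltM PmxM.
Qed.

Lemma lin_Psi (x : comb k bool) :
  lin Psi x = (n`!%:R)^-1 *: \sum_(s : 'S_n) (lin grcoord (relabel s x) *m Qmx *m Pmx s).
Proof.
elim: x => [|p x IH].
  rewrite lin_nil big1 ?scaler0 // => s _; by rewrite [lin grcoord _]lin_nil !mul0mx.
rewrite lin_cons IH /Psi scalerA mulrC -scalerA -scalerDr; congr (_ *: _).
rewrite scaler_sumr -big_split; apply: eq_bigr => s _ /=.
by rewrite [lin grcoord (relabel s (_ :: _))]lin_cons /= !mulmxDl -!scalemxAl.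
Qed.

Lemma relabel_ideal (s : 'S_n) (g : comb k bool) : fman_ideal n g -> fman_ideal n (relabel s g).
Proof.
move=> ig; have [_ [_ [_ [_ [_ _ _ ag]]]]] := ig; apply: pgen_ideal_gen => //.
  exact/pgen_csubst/(ideal_gen_pgen ig).
by apply/allP => _ /mapP[p pg ->] /=; apply: arity_relt; apply: (allP ag).
Qed.

Lemma Psi_ideal g : fman_ideal n g -> lin Psi g = 0.
Proof.
move=> ig; rewrite lin_Psi big1 ?scaler0 // => s _.
by rewrite (kap_ideal chark0 (relabel_ideal s ig)) !mul0mx.
Qed.

(** In normal-form coordinates [q t] has nothing below degree [nbrk t], and [grcoord] keeps
    precisely that degree. *)
Lemma Fdeg_kap t : arity n t -> Fdeg (nbrk t).+1 (q t - grcoord t *m Qmx).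
Proof.
move=> at_; have [c qE c0] := Fdeg_q k at_.
exists (c - grcoord t) => [|i]; first by rewrite mulmxBl qE.
have -> : (c - grcoord t) 0 i = c 0 i - grcoord t 0 i by rewrite [LHS]mxE [X in _ + X]mxE.
rewrite [grcoord t 0 i]mxE qE mulmxK ?Qmx_unit //.
rewrite ltnS leq_eqVlt => /predU1P[->|lt]; first by rewrite eqxx subrr.
by rewrite c0 // ltn_eqF // subr0.
Qed.

(** [q t] equals the average of [q (relt s t) *m Pmx s]; termwise it differs from [Psi t] by
    elements of the next filtration step. *)
Lemma Fdeg_Psi t : arity n t -> Fdeg (nbrk t).+1 (q t - Psi t).
Proof.
move=> at_.
have -> : q t - Psi t = (n`!%:R)^-1 *:
    (\sum_(s : 'S_n) (q (relt s t) - grcoord (relt s t) *m Qmx) *m Pmx s) + 0.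
  rewrite addr0; under [in RHS]eq_bigr => s _ do rewrite mulmxBl q_relt.
  rewrite sumrB scalerBr; congr (_ - _).
  by rewrite sumr_const card_Sn -scaler_nat scalerA mulVf ?factn_neq0 // scale1r.
apply: Fdeg_lin; last exact: Fdeg0.
elim/big_rec: _ => [|s v _ Fv]; first exact: Fdeg0.
rewrite -[X in X + _]scale1r; apply: Fdeg_lin Fv; apply: Fdeg_Pmx.
by rewrite -(nbrk_relt s t); apply: Fdeg_kap; apply: arity_relt.
Qed.

Definition Wmx : 'M[k]_N := \matrix_i Psi (nf i).

(** In normal-form coordinates, [Psi (nf i)] is the i-th unit vector plus terms with strictly more
    brackets. *)
Lemma Wmx_unit : Wmx \in unitmx.
Proof.
have -> : Wmx = Wmx *m invmx Qmx *m Qmx by rewrite mulmxKV ?Qmx_unit.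
rewrite unitmx_mul Qmx_unit // andbT.
have WE i : exists2 c : 'rV[k]_N, row i (Wmx *m invmx Qmx) = delta_mx 0 i - c &
    forall j, (nbrk (nf j) <= nbrk (nf i))%N -> c 0 j = 0.
  have [c cE c0] := Fdeg_Psi (arity_nf i); exists c => //.
  have -> : row i (Wmx *m invmx Qmx) = Psi (nf i) *m invmx Qmx by rewrite row_mul rowK.
  have -> : Psi (nf i) = q (nf i) - c *m Qmx by rewrite -cE opprB addrC subrK.
  by rewrite mulmxBl mulmxK ?Qmx_unit // -row_Qmx rowE mulmxK ?Qmx_unit.
have entry i j : (Wmx *m invmx Qmx) i j = row i (Wmx *m invmx Qmx) 0 j by rewrite [RHS]mxE.
apply: (@unitriangular_unitmx _ _ _ (fun i => nbrk (nf i))) => [i|i j].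
  by have [c cE c0] := WE i; rewrite entry cE !mxE !eqxx c0 // subr0.
have [c cE c0] := WE i; rewrite entry cE !mxE eqxx /=.
case: (eqVneq j i) => [->|ne]; first by left.
by rewrite sub0r oppr_eq0 => cj; right; rewrite ltnNge; apply: contra cj => /c0 ->.
Qed.

Definition psi (T : rtree n) : comb k bool := nfcomb (fun i => invmx Wmx (enum_rank T) i).

Lemma Psi_psi T : lin Psi (psi T) = delta_mx 0 (enum_rank T).
Proof.
rewrite lin_nfcomb.
have -> : \sum_i invmx Wmx (enum_rank T) i *: Psi (nf i) = row (enum_rank T) (invmx Wmx) *m Wmx.
  by rewrite mulmx_sum_row; apply: eq_bigr => i _; rewrite mxE rowK.
by rewrite -row_mul mulVmx ?Wmx_unit // rowE mulmx1.
Qed.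

(** Applying [Psi] to the expansion of [x] in normal forms gives [lin grcoord x *m Wmx = 0], so the
    coordinates of [x] vanish. *)
Lemma Psi_ker x : all_arity n x -> lin Psi x = 0 -> in_span (@fman_ideal k n) x.
Proof.
move=> ax x0; apply: (kap_ker chark0 ax).
have := lin_span (P := fun v => v = 0) erefl _ Psi_ideal (kap_span chark0 ax).
rewrite lin_csub x0 lin_nfcomb sub0r => /(_ _)/eqP; rewrite oppr_eq0 => h.
have {h} /eqP : \sum_i lin grcoord x 0 i *: Psi (nf i) == 0.
  by apply: h => a u v -> ->; rewrite scaler0 addr0.
have -> : \sum_i lin grcoord x 0 i *: Psi (nf i) = lin grcoord x *m Wmx.
  by rewrite mulmx_sum_row; apply: eq_bigr => i _; rewrite rowK.
by move/(congr1 (mulmx^~ (invmx Wmx))); rewrite mulmxK ?Wmx_unit // mul0mx.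
Qed.

Lemma all_arity_psi T : all_arity n (psi T).
Proof. exact: all_arity_nfcomb. Qed.

Lemma psi_basis : basis_mod (@fman_ideal k n) n [seq psi T | T <- enum {: rtree n}].
Proof.
apply: (basis_mod_dual (Phi := Psi)) => [|_ /mapP[T _ ->]|||].
- by rewrite size_map -cardE.
- exact: all_arity_psi.
- exact: Psi_ideal.
- move=> i; have [T0 _] : exists T0 : rtree n, True by exists (enum_val i).
  rewrite (nth_map T0) -?cardE // Psi_psi; congr delta_mx.
  by rewrite -[nth _ _ _](enum_val_nth T0 i) enum_valK.
- exact: Psi_ker.
Qed.

Lemma psi_equivariant (s : 'S_n) (T T' : rtree n) :
  (forall i, val T' i = omap s (val T (s^-1 i))%g) ->
  in_span (@fman_ideal k n) (csub (relabel s (psi T)) (psi T')).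
Proof.
move=> TT'; have {TT'} -> : T' = act s T.
  by apply/val_inj/ffunP => i; rewrite TT' ffunE.
apply: Psi_ker.
  rewrite /all_arity (all_csub (arity n)) -!/(all_arity n _) all_arity_psi andbT.
  apply/allP => _ /mapP[p pT ->] /=; apply: arity_relt; exact: (allP (all_arity_psi T)).
rewrite lin_csub Psi_psi; apply/eqP; rewrite subr_eq0; apply/eqP.
have linE' : lin Psi (relabel s (psi T)) *m Pmx s = lin Psi (psi T).
  rewrite /lin big_map mulmx_suml; apply: eq_bigr => p _ /=.
  by rewrite -scalemxAl Psi_relt.
(* Every column has the form [rk s j], and there [mul_Pmx] and the equivariance of [Psi] give the
   entry. *)
apply/rowP => j; have -> : j = rk s (rk s^-1%g j).
  by rewrite -rkM mulVg /rk act1 /nth_rtree enum_valK.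
move: (rk _ j) => {}j; rewrite -mul_Pmx linE' Psi_psi !mxE eqxx /= /rk.
congr (nat_of_bool _)%:R; apply/eqP/eqP => [->|/enum_rank_inj e].
  by rewrite /nth_rtree enum_rankK.
have <- : nth_rtree j = T by rewrite -[LHS]act1 -[RHS]act1 -(mulgV s) !actM e.
by rewrite /nth_rtree enum_valK.
Qed.

End Equivariant.

(** * Cayley's formula *)

Section Cayley.
Variable n : nat.
Local Notation pfun := {ffun 'I_n -> option 'I_n}.
Implicit Types (f : pfun) (i j r v : 'I_n).
Local Open Scope nat_scope.

Definition step f (x : option 'I_n) := obind f x.
Definition forest f := [forall i, iter n (step f) (Some i) == None].
Definition nroots f := #|[pred i | f i == None]|.
Definition upd f r x : pfun := [ffun i => if i == r then x else f i].

Lemma iter_step_None f d : iter d (step f) None = None.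
Proof. by elim: d => //= d ->. Qed.

Lemma iter_step_le f x d d' : d <= d' -> iter d (step f) x = None -> iter d' (step f) x = None.
Proof. by move=> /subnK <-; rewrite iterD => ->; apply: iter_step_None. Qed.

(* Pigeonhole: an orbit that dies at all dies after visiting at most n points. *)
Lemma iter_step_bound f i d : iter d (step f) (Some i) = None -> iter n (step f) (Some i) = None.
Proof.
move=> dN; apply/eqP; apply: contraT => nN.
have sub : {subset traject (step f) (Some i) n.+1 <= [seq Some j | j <- enum 'I_n]}.
  move=> x /trajectP[e en ->]; case E : (iter e _ _) => [j|].
    by apply: map_f; rewrite mem_enum.
  by rewrite (iter_step_le _ E) ?eqxx in nN.
have : looping (step f) (Some i) n.
  rewrite -[looping _ _ _]negbK -looping_uniq; apply/negP => u.
  have := uniq_leq_size u sub; rewrite size_traject size_map -cardE card_ord.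
  by rewrite ltnn.
move=> /loopingP/(_ d); rewrite dN => /trajectP[e en E].
by rewrite (iter_step_le (ltnW en) (esym E)) ?eqxx in nN.
Qed.

(** For a root r: v belongs to the tree of r. The bound on d makes this a boolean; [reachP] lifts
    it. *)
Definition reach f v r := [exists d : 'I_n.+1, iter d (step f) (Some v) == Some r].

Lemma reachP f v r : f r = None ->
  reflect (exists d, iter d (step f) (Some v) = Some r) (reach f v r).
Proof.
move=> fr; apply: (iffP existsP) => [[d /eqP]|[d dE]]; first by exists d.
have dN : iter d.+1 (step f) (Some v) = None by rewrite /= dE.
have nN := iter_step_bound dN.
have dn : d < n.+1.
  rewrite ltnS leqNgt; apply/negP => /ltnW nd.
  by rewrite (iter_step_le nd nN) in dE.
by exists (Ordinal dn); apply/eqP.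
Qed.

(** The last living point of the orbit of v is a root, and an orbit stops at the first root it
    meets. *)
Lemma reach_root f v : forest f -> exists r0, [pred r | (f r == None) && reach f v r] =i pred1 r0.
Proof.
move=> /forallP/(_ v)/eqP fv.
have n0 : 0 < n by apply: leq_ltn_trans (ltn_ord v).
have ex : exists d, iter d.+1 (step f) (Some v) == None by exists n.-1; rewrite prednK // fv.
case: (ex_minnP ex) => d0 /eqP d0N dmin.
have [r0 r0E] : exists r0, iter d0 (step f) (Some v) = Some r0.
  case E : (iter d0 _ _) => [r0|]; first by exists r0.
  case: d0 E dmin {d0N} => // d E /(_ d); rewrite E eqxx ltnn => h.
  by have := h isT.
have fr0 : f r0 = None by move: d0N; rewrite /= r0E.
exists r0 => r; rewrite !inE; apply/andP/eqP => [[/eqP fr /(reachP _ fr)[d dE]]|->]; last first.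
  by rewrite fr0; split=> //; apply/(reachP _ fr0); exists d0.
have dN : iter d.+1 (step f) (Some v) = None by rewrite /= dE.
have d0d : d0 <= d by apply: dmin; rewrite dN.
case: (ltngtP d0 d) d0d => // [lt _|e _]; first by rewrite (iter_step_le lt d0N) in dE.
by move: dE; rewrite -e r0E => -[].
Qed.

Lemma iter_upd f r x y d : (forall e, e < d -> iter e (step f) y != Some r) ->
  iter d (step (upd f r x)) y = iter d (step f) y.
Proof.
elim: d => //= d IH nr; rewrite IH => [|e ed]; last by apply: nr; apply: ltnW.
have := nr d (ltnSn d); case: (iter d _ y) => //= j.
by rewrite ffunE; case: (j =P r) => [->|//]; rewrite eqxx.
Qed.

Lemma reach_first f v r : f r = None -> reach f v r -> exists2 d,
  iter d (step f) (Some v) = Some r & forall e, e < d -> iter e (step f) (Some v) != Some r.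
Proof.
move=> fr /(reachP _ fr)[d dE].
have ex : exists d, iter d (step f) (Some v) == Some r by exists d; apply/eqP.
case: (ex_minnP ex) => m /eqP mE mmin; exists m => // e em.
by apply/negP => /mmin; rewrite leqNgt em.
Qed.

(** Hanging the root r below v closes a cycle exactly when v already lies in the tree of r. *)
Lemma forest_upd f r v : f r = None -> forest f -> forest (upd f r (Some v)) = ~~ reach f v r.
Proof.
move=> fr ff; apply/idP/idP => [ff'|nvr].
  apply/negP => /(reach_first fr)[d dE dmin].
  have cyc : iter d.+1 (step (upd f r (Some v))) (Some v) = Some v.
    by rewrite iterS (iter_upd _ dmin) dE /= ffunE eqxx.
  have cycs m : iter (m * d.+1) (step (upd f r (Some v))) (Some v) = Some v.
    by elim: m => // m IH; rewrite mulSn iterD IH cyc.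
  have := eqP (forallP ff' v) => /(iter_step_le (leq_pmulr n (ltn0Sn d))).
  by rewrite cycs.
have unreached j : ~~ reach f j r -> iter n (step (upd f r (Some v))) (Some j) = None.
  move=> njr; rewrite iter_upd; first exact: eqP (forallP ff j).
  by move=> e _; apply: contra njr => /eqP h; apply/(reachP _ fr); exists e.
apply/forallP => i; apply/eqP; have [/(reach_first fr)[d dE dmin]|/unreached //] := boolP (reach f i r).
(* Until its first visit to r the orbit is unchanged; one more step leads to v, whose orbit avoids r
   and dies within n steps. *)
apply: (@iter_step_bound _ _ (n + d.+1)); rewrite iterD iterS (iter_upd _ dmin) dE /= ffunE eqxx.
exact: unreached.
Qed.

Lemma forest_cut f r v : f r = None -> forest (upd f r (Some v)) -> forest f.
Proof.
move=> fr ff'; apply/forallP => i; apply/eqP.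
have [/(reachP _ fr)[d dE]|nir] := boolP (reach f i r).
  by apply: (@iter_step_bound _ _ d.+1); rewrite /= dE.
rewrite -(@iter_upd _ r (Some v)); first exact: eqP (forallP ff' i).
by move=> e _; apply: contra nir => /eqP h; apply/(reachP _ fr); exists e.
Qed.

Lemma nroots_upd f r v : f r = None -> nroots f = (nroots (upd f r (Some v))).+1.
Proof.
move=> fr; rewrite /nroots (cardD1 r) inE fr eqxx add1n; congr _.+1.
apply: eq_card => i; rewrite !inE ffunE; case: eqP => //= _.
Qed.

Definition nforest m := #|[pred f | forest f && (nroots f == m)]|.

(** Each v lies in the tree of exactly one of the m+1 roots, which leaves m roots for it. *)
Lemma sum_unreached f m : forest f -> nroots f = m.+1 ->
  \sum_(r | f r == None) \sum_v ~~ reach f v r = n * m.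
Proof.
move=> ff fm; rewrite exchange_big /= -[X in X * m](card_ord n) -sum_nat_const.
apply: eq_bigr => v _; have [r0 r0E] := reach_root v ff.
have := cardID [pred r | reach f v r] [pred r | f r == None].
rewrite -/(nroots f) fm.
have -> : #|[predI [pred r | f r == None] & [pred r | reach f v r]]| = 1.
  by rewrite (eq_card r0E) card1.
rewrite add1n => -[<-]; rewrite -sum1_card big_mkcond [RHS]big_mkcond /=.
apply: eq_bigr => r _; rewrite !inE.
by case: (f r == None); case: (reach f v r).
Qed.

(* Double counting of the pairs of a forest with m + 1 roots and a forest with m roots that differ
   by one edge. *)
Lemma nforest_step m : nforest m.+1 * (n * m) = nforest m * (n - m).
Proof.
rewrite /nforest -!sum_nat_const.
transitivity (\sum_(f : pfun) \sum_(r : 'I_n) \sum_(v : 'I_n)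
   ((f r == None) && (forest (upd f r (Some v)) && (nroots (upd f r (Some v)) == m)))).
  rewrite big_mkcond; apply: eq_bigr => f _; rewrite inE.
  case: ifP => [/andP[ff /eqP fm]|nff].
    rewrite -(sum_unreached ff fm) big_mkcond; apply: eq_bigr => r _.
    case: eqP => fr; last by rewrite big1.
    apply: eq_bigr => v _; rewrite forest_upd //.
    by move: fm; rewrite (nroots_upd v fr) => -[->]; rewrite eqxx andbT.
  rewrite big1 // => r _; rewrite big1 // => v _.
  case: eqP => //= fr; apply/eqP; rewrite eqb0; apply/negP => /andP[ff /eqP fm].
  by rewrite (forest_cut fr ff) (nroots_upd v fr) fm eqxx in nff.
(* Seen from the forest with m roots, the pairs are its n - m edges, one for each non-root r. *)
transitivity (\sum_(f : pfun) \sum_(r : 'I_n) ((f r != None) && (forest f && (nroots f == m)))); last first.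
  rewrite [RHS]big_mkcond; apply: eq_bigr => f _; rewrite inE.
  case: ifP => [/andP[ff /eqP fm]|_]; last by rewrite big1 // => r _; rewrite andbF.
  rewrite -fm /nroots -[X in X - _](card_ord n) -(cardC [pred i | f i == None]) addKn.
  rewrite -sum1_card [RHS]big_mkcond /=; apply: eq_bigr => r _.
  by rewrite !inE andbT; case: (f r == None).
rewrite exchange_big [RHS]exchange_big; apply: eq_bigr => r _ /=.
rewrite pair_bigA /=.
transitivity (\sum_(f : pfun | f r != None) (forest f && (nroots f == m))); last first.
  by rewrite big_mkcond; apply: eq_bigr => f _; case: (f r != None).
(* With r fixed, a function having r as a root together with a new parent v amounts to a function
   with a value at r: cutting at r and reading off that value is the inverse. *)
rewrite (reindex_onto (fun p : pfun * 'I_n => upd p.1 r (Some p.2))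
   (fun f => (upd f r None, odflt r (f r)))) /=; last first.
  move=> f fr; apply/ffunP => i; rewrite !ffunE; case: eqP => // ->.
  by case: (f r) fr.
rewrite [RHS]big_mkcond; apply: eq_bigr => -[f v] _ /=; rewrite !ffunE eqxx /=.
have -> : ((upd (upd f r (Some v)) r None, v) == (f, v)) = (f r == None).
  rewrite xpair_eqE eqxx andbT; apply/eqP/eqP => [<-|fr]; first by rewrite ffunE eqxx.
  by apply/ffunP => i; rewrite !ffunE; case: eqP => // ->.
by case: (f r == None).
Qed.

Lemma nforest_bin m : 0 < n -> m < n -> nforest (n - m) = n ^ m * 'C(n.-1, m).
Proof.
move=> n0; elim: m => [|m IH] mn.
  rewrite subn0 expn0 bin0 muln1; apply/eqP/card1P.
  exists [ffun=> None] => f; rewrite !inE; apply/andP/eqP => [[_ /eqP c]|->].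
    apply/ffunP => i; rewrite ffunE; apply/eqP.
    have /subset_cardP : #|[pred i | f i == None]| = #|'I_n| by rewrite card_ord.
    by move=> /(_ (subset_predT _))/(_ i); rewrite !inE.
  split; last by apply/eqP; rewrite /nroots -[RHS]card_ord; apply: eq_card => i; rewrite !inE ffunE.
  apply/forallP => i; apply/eqP; apply: (@iter_step_bound _ _ 1) => /=; by rewrite ffunE.
(* With n - m.+1 roots there are m.+1 edges; this factor is cancelled and matched with the recursion
   for binomials. *)
have := nforest_step (n - m.+1); rewrite (subnSK (ltnW mn)) (IH (ltnW mn)) (subKn (ltnW mn)) => E; apply/eqP; rewrite -(eqn_pmul2r (ltn0Sn m)) -E; apply/eqP.
have := mul_bin_left n.-1 m; rewrite -subn1 -subnDA add1n => b.
rewrite expnS -!mulnA [m.+1 * _]mulnC in b *.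
rewrite b; nia.
Qed.

(** Rooted trees are the forests with one root, that is, with n-1 edges, where the binomial
    coefficient is 1. *)
Lemma card_rtree : 0 < n -> #|{: rtree n}| = n ^ n.-1.
Proof.
move=> n0; rewrite card_sig.
have lt : n.-1 < n by rewrite prednK.
have := nforest_bin n0 lt; rewrite binn muln1 (_ : n - n.-1 = 1) => [<-|]; last by lia.
by apply: eq_card => f; rewrite !inE andbC.
Qed.

End Cayley.

Theorem theorem3 (k : fieldType) (chark0 : [pchar k] =i pred0) :
  (* gr_F PreLie ~= FMan, via the canonical map sending o and [-,-] to the
     classes of o (in F^0/F^1) and [-,-] (in F^1/F^2):
     (i) on bracket-degree j, its kernel is exactly the FMan ideal *)
  (forall (n j : nat) (x : comb k bool),
     all_arity n x -> all (fun p => nbrk p.2 == j) x ->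
     (in_span (@Fgen k n j.+1) (ev_comb x) <-> in_span (@fman_ideal k n) x)) /\
  (* (ii) it is onto F^j/F^{j+1} *)
  (forall (n j : nat) (y : comb k unit),
     in_span (@Fgen k n j) y ->
     exists x : comb k bool,
       [/\ all_arity n x, all (fun p => nbrk p.2 == j) x &
           in_span (@Fgen k n j.+1) (csub y (ev_comb x))]) /\
  (* dim FMan(n) = n^(n-1) *)
  (forall n : nat, (0 < n)%N ->
     exists bs : seq (comb k bool),
       size bs = (n ^ n.-1)%N /\ basis_mod (@fman_ideal k n) n bs) /\
  (* FMan(n) is isomorphic, as an S_n-module, to the permutation module on
     rooted trees with vertex set {0,...,n-1} *)
  (forall n : nat,
     exists psi : rtree n -> comb k bool,
       basis_mod (@fman_ideal k n) n [seq psi T | T <- enum {: rtree n}] /\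
       (forall (s : 'S_n) (T T' : rtree n),
          (forall i, val T' i = omap s (val T (s^-1 i))%g) ->
          in_span (@fman_ideal k n) (csub (relabel s (psi T)) (psi T')))).
Proof.
split; first exact: gr_kernel.
split; first exact: gr_surjective.
split=> [n n0|n].
  exists [seq psi k T | T <- enum {: rtree n}]; split; last exact: psi_basis.
  by rewrite size_map -cardE card_rtree.
by exists (@psi k n); split; [apply: psi_basis|apply: psi_equivariant].
Qed.
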